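(* Let $\Gamma=(G,\sigma)$ be a signed graph with $G=(V,E)$, $|V|=n$, and let $\mathcal G$ be the set of all subgraphs of $\Gamma$; for $\Gamma_0\in\mathcal G$ let $|V_{\Gamma_0}|$ be its number of vertices. For $1\le k\le n$, $$L_k(\Gamma)\ \ge\ \frac12\max_{\substack{\Gamma_0\in\mathcal G\\ |V_{\Gamma_0}|\ge n-k+1}}\lambda_{|V_{\Gamma_0}|-n+k}(A^\mu_{-\Gamma_0})\ =\ \frac12\max_{\substack{\Gamma_0\in\mathcal G\\ |V_{\Gamma_0}|=n}}\lambda_k(A^\mu_{-\Gamma_0}).$$ For $k=n$ the inequality is an equality, and moreover $$L_n(\Gamma)=\frac12\max_{\substack{\Gamma_0\in\mathcal G,\ |V_{\Gamma_0}|=n\\ \Gamma_0\text{ antibalanced}}}\lambda_n(A^\mu_{-\Gamma_0}).$$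
   Context: $G=(V,E)$ is a finite undirected graph without self-loops, $V=\{1,\dots,n\}$. A signed graph $\Gamma=(G,\sigma)$ has signature $\sigma:E\to\{\pm1\}$, $\sigma_{ij}=\sigma(\{i,j\})$, edge weight $w:E\to(0,\infty)$, vertex measure $\mu:V\to(0,\infty)$, potential $\kappa:V\to\mathbb R$. A subgraph $\Gamma_0=(G_0,\sigma)$ of $\Gamma$ has $G_0=(V_0,E_0)$ with $V_0\subset V$, $E_0\subset E$ consisting of edges with both endpoints in $V_0$, and carries the restrictions of $\sigma,w,\mu,\kappa$. $-\Gamma=(G,-\sigma)$. The adjacency matrix $A_\Gamma$ has entries $a_{ij}=\sigma_{ij}w_{ij}$ if $i\sim j$ and $0$ otherwise; the normalized adjacency matrix is $A^\mu_\Gamma=D^{-1}A_\Gamma$, $D=\mathrm{diag}(\mu_1,\dots,\mu_n)$; its eigenvalues (real) are ordered $\lambda_1\le\dots\le\lambda_n$. A switching function $\tau:V\to\{\pm1\}$ changes $\sigma$ to $\sigma^\tau_{ij}=\tau(i)\sigma_{ij}\tau(j)$; $\Gamma$ is antibalanced if $\sigma^\tau\equiv-1$ for some $\tau$. For $p\ge1$ and nonzero $f$, $\mathcal R_p^\sigma(f)=\frac{\sum_{\{i,j\}\in E}w_{ij}|f(i)-\sigma_{ij}f(j)|^p+\sum_i\kappa_i|f(i)|^p}{\sum_i\mu_i|f(i)|^p}$; $\mathcal S_p=\{f:\sum_i\mu_i|f(i)|^p=1\}$; the Krasnoselskii genus $\gamma(B)$ of a closed symmetric $B\subset\mathbb R^n\setminus\{0\}$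 is the least $k$ with an odd continuous map $B\to\mathbb R^k\setminus\{0\}$; $\mathcal F_k(\mathcal S_p)$ = closed symmetric $B\subset\mathcal S_p$ with $\gamma(B)\ge k$; $\lambda_k^{(p)}(\Gamma)=\min_{B\in\mathcal F_k(\mathcal S_p)}\max_{f\in B}\mathcal R_p^\sigma(f)$. Cut-off adjacency eigenvalues: $L_k(\Gamma):=\lim_{p\to\infty}2^{-p}\lambda_k^{(p)}(\Gamma)$ (limits exist, independent of $\kappa$). *)

(* Defs.v *)
From HB Require Import structures.
From mathcomp Require Import all_boot all_order all_algebra.
From mathcomp Require Import all_classical all_reals all_analysis.
Set Implicit Arguments. Unset Strict Implicit. Unset Printing Implicit Defensive.
Import Order.TTheory GRing.Theory Num.Theory.
Import numFieldNormedType.Exports.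
Local Open Scope classical_set_scope.
Local Open Scope ring_scope.

Section SignedGraph.
Variable R : realType.

(* The ascending list of eigenvalues (with algebraic multiplicity) of M,
   i.e. the sorted list s with char_poly M = prod_(x <- s) ('X - x).
   (Well-defined whenever the characteristic polynomial splits over R.) *)
Definition eigs (m : nat) (M : 'M[R]_m) : seq R :=
  xget [::] [set s : seq R | sorted <=%R s /\
                             char_poly M = \prod_(x <- s) ('X - x%:P)].

Definition eig (m : nat) (M : 'M[R]_m) (k : nat) : R := nth 0 (eigs M) k.-1.

(* adj : edge relation of G; sigma, w : signature and edge weights
   (only their values on edges matter); mu : vertex measure; kappa : potential *)
Definition signed_graph (n : nat) (adj : rel 'I_n) (sigma w : 'I_n -> 'I_n -> R)
    (mu : 'I_n -> R) : Prop :=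
  [/\ (forall i j, adj i j = adj j i),
      (forall i, ~~ adj i i),
      (forall i j, adj i j -> sigma i j = sigma j i /\ (sigma i j = 1 \/ sigma i j = -1)),
      (forall i j, adj i j -> w i j = w j i /\ 0 < w i j) &
      (forall i, 0 < mu i)].

Definition is_subgraph (n : nat) (adj : rel 'I_n) (V0 : {set 'I_n}) (E0 : rel 'I_n)
  : Prop :=
  (forall i j, E0 i j = E0 j i) /\
  (forall i j, E0 i j -> [/\ adj i j, i \in V0 & j \in V0]).

(* normalized adjacency matrix D^{-1} A of the subgraph (V0,E0) with signature
   sgn (restrictions of w, mu); vertices of V0 enumerated by enum_val *)
Definition norm_adj (n : nat) (V0 : {set 'I_n}) (E0 : rel 'I_n)
    (sgn w : 'I_n -> 'I_n -> R) (mu : 'I_n -> R) : 'M[R]_#|V0| :=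
  \matrix_(i, j)
    ((if E0 (enum_val i) (enum_val j)
      then sgn (enum_val i) (enum_val j) * w (enum_val i) (enum_val j) else 0)
     / mu (enum_val i)).

Definition norm_adj_neg (n : nat) (V0 : {set 'I_n}) (E0 : rel 'I_n)
    (sigma w : 'I_n -> 'I_n -> R) (mu : 'I_n -> R) : 'M[R]_#|V0| :=
  norm_adj V0 E0 (fun i j => - sigma i j) w mu.

Definition antibalanced (n : nat) (E0 : rel 'I_n) (sigma : 'I_n -> 'I_n -> R) : Prop :=
  exists tau : 'I_n -> R, (forall i, tau i = 1 \/ tau i = -1) /\
    (forall i j, E0 i j -> tau i * sigma i j * tau j = -1).

Definition pnum (n : nat) (adj : rel 'I_n) (sigma w : 'I_n -> 'I_n -> R)
    (kappa : 'I_n -> R) (p : R) (f : 'rV[R]_n) : R :=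
  \sum_(i < n) \sum_(j < n | (i < j)%N && adj i j)
       w i j * `|f ord0 i - sigma i j * f ord0 j| `^ p
  + \sum_(i < n) kappa i * `|f ord0 i| `^ p.

Definition pden (n : nat) (mu : 'I_n -> R) (p : R) (f : 'rV[R]_n) : R :=
  \sum_(i < n) mu i * `|f ord0 i| `^ p.

Definition Rayleigh (n : nat) (adj : rel 'I_n) (sigma w : 'I_n -> 'I_n -> R)
    (mu kappa : 'I_n -> R) (p : R) (f : 'rV[R]_n) : R :=
  pnum adj sigma w kappa p f / pden mu p f.

Definition psphere (n : nat) (mu : 'I_n -> R) (p : R) : set 'rV[R]_n :=
  [set f | pden mu p f = 1].

Definition odd_map_to (n : nat) (B : set 'rV[R]_n) (j : nat) : Prop :=
  exists g : 'rV[R]_n -> 'rV[R]_j,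
    [/\ {within B, continuous g},
        (forall x, B x -> g (- x) = - g x) &
        (forall x, B x -> g x != 0)].

Definition genus_ge (n : nat) (B : set 'rV[R]_n) (k : nat) : Prop :=
  forall j : nat, (j < k)%N -> ~ odd_map_to B j.

Definition Fk (n : nat) (mu : 'I_n -> R) (p : R) (k : nat) : set (set 'rV[R]_n) :=
  [set B | [/\ B `<=` psphere mu p, closed B,
               (forall x, B x -> B (- x)) & genus_ge B k]].

Definition lambdap (n : nat) (adj : rel 'I_n) (sigma w : 'I_n -> 'I_n -> R)
    (mu kappa : 'I_n -> R) (k : nat) (p : R) : R :=
  inf [set x | exists2 B, Fk mu p k B &
                 x = sup [set Rayleigh adj sigma w mu kappa p f | f in B]].

Definition Lcut (n : nat) (adj : rel 'I_n) (sigma w : 'I_n -> 'I_n -> R)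
    (mu kappa : 'I_n -> R) (k : nat) : R :=
  lim ((2 : R) `^ (- p) * lambdap adj sigma w mu kappa k p @[p --> +oo]).

End SignedGraph.

(* Main.v *)
Require Import Defs.
From HB Require Import structures.
From mathcomp Require Import all_boot all_order all_algebra.
From mathcomp Require Import all_classical all_reals all_analysis.
From mathcomp Require Import ring lra zify.
Import Order.TTheory GRing.Theory Num.Theory.
Import numFieldNormedType.Exports.
Set Implicit Arguments. Unset Strict Implicit. Unset Printing Implicit Defensive.
Local Open Scope classical_set_scope.
Local Open Scope ring_scope.

(* Write [f = psi (2 / p) g], i.e. [f i = sgn (g i) * |g i| ^ (2 / p)]: these odd
   homeomorphisms identify all the spheres S_p with S_2. By AM-GM and Bernoulli,
   [2 ^ -p * R_p (f)] is within [O(1 / p)], uniformly on S_2, of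
     [Q (g) = \sum_(ij edge) w_ij * max (0, - sigma_ij * g_i * g_j)],
   so that [L_k] is the min-max value of [Q] over symmetric sets of genus >= k.
   For every subgraph, [2 * Q] dominates the quadratic form of the adjacency
   matrix of the negated subgraph; a set of genus >= k meets every subspace of
   codimension k - 1, which by Courant-Fischer gives the lower bound, and
   deleting vertices instead of isolating them never increases the eigenvalues.
   For k = n the only competitor needed is the whole sphere, and [2 * Q (g)] is
   the quadratic form of the antibalanced subgraph of the edges on which
   [sigma_ij * g_i * g_j < 0].
   That S_2 has genus n is the Borsuk-Ulam theorem, proved by Ky Fan's parity
   argument on iterated barycentric subdivisions of the cross-polytope. *)

(** * F_2-chains and Ky Fan's parity argument *)

(* Chains with coefficients in F_2 are sequences of simplices, a simplex is the
   sequence of its vertices, and a chain is only used through the parities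
   [\big[addb/false]_(s <- c) f s]. The complex is augmented: the boundary of a
   vertex is the empty simplex. *)
Fixpoint bd {T : Type} (s : seq T) : seq (seq T) :=
  if s is x :: t then t :: map (cons x) (bd t) else [::].

Lemma bd_map (T U : Type) (h : T -> U) s : bd (map h s) = map (map h) (bd s).
Proof.
by elim: s => //= x s ->; rewrite -!map_comp; congr cons; apply: eq_map.
Qed.

(** The facet [s] of [x :: s] contributes [bd s], which cancels against the faces that lose [x]
    second; the rest is the induction hypothesis. *)
Lemma bd_bd (T : Type) (f : seq T -> bool) s :
  \big[addb/false]_(t <- bd s) \big[addb/false]_(u <- bd t) f u = false.
Proof.
elim: s f => [|x s IH] f /=; first by rewrite big_nil.
rewrite big_cons big_map /=.
under [X in _ (+) X]eq_bigr do rewrite big_cons big_map.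
by rewrite big_split /= addbA addbb IH.
Qed.

Lemma size_bd (T : eqType) (s t : seq T) : t \in bd s -> (size t).+1 = size s.
Proof.
elim: s t => //= x s IH t; rewrite inE => /orP[/eqP ->//|].
by move=> /mapP[u /IH us ->] /=; rewrite us.
Qed.

Lemma bd_subseq (T : eqType) (s t : seq T) : t \in bd s -> subseq t s.
Proof.
elim: s t => //= x s IH t; rewrite inE => /orP[/eqP ->|].
  exact: subseq_cons.
by move=> /mapP[u /IH us ->] /=; rewrite eqxx.
Qed.

(** When vertices repeat, [rem] deletes the first copy rather than the chosen one, so the facets
    agree only up to reordering; hence the invariance asked of [f]. *)
Lemma big_bd_rem (T : eqType) (f : seq T -> bool) s :
    (forall a b, perm_eq a b -> f a = f b) ->
  \big[addb/false]_(t <- bd s) f t = \big[addb/false]_(x <- s) f (rem x s).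
Proof.
elim: s f => [|x s IH] f fP /=; first by rewrite !big_nil.
rewrite !big_cons eqxx big_map (IH (f \o cons x)) /=; last first.
  by move=> a b ab; apply: fP; rewrite perm_cons.
congr addb; apply: eq_big_seq => y ys; apply: fP.
by case: eqVneq ys => [<- ys|//]; rewrite perm_sym perm_to_rem.
Qed.

Lemma big_bd_perm (T : eqType) (f : seq T -> bool) s s' :
    (forall a b, perm_eq a b -> f a = f b) -> perm_eq s s' ->
  \big[addb/false]_(t <- bd s) f t = \big[addb/false]_(t <- bd s') f t.
Proof.
move=> fP ss'; rewrite !big_bd_rem// (perm_big _ ss') /=.
apply: eq_big_seq => x xs'; apply: fP; rewrite -(perm_cons x).
have xs : x \in s by rewrite (perm_mem ss').
rewrite -(permPl (perm_to_rem xs)) (permPl ss').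
exact: perm_to_rem.
Qed.

Fixpoint alternating (c : bool) (s : seq bool) :=
  if s is x :: t then (x == c) && alternating (~~ c) t else true.

Lemma alternating_negb c s : alternating c (map negb s) = alternating (~~ c) s.
Proof. by elim: s c => //= x s IH c; rewrite IH; case: x c => -[]. Qed.

(** If the first letter is [c], deleting it gives a term that cancels against the induction
    hypothesis for [~~ c]; otherwise only the deletion of that letter can produce an alternating
    word. *)
Lemma alternating_bd c s :
  \big[addb/false]_(t <- bd s) alternating c t =
  alternating c s (+) alternating (~~ c) s.
Proof.
elim: s c => [|x s IH] c /=; first by rewrite big_nil.
rewrite big_cons big_map negbK /=.
case: eqVneq => [->|xc] /=.
  rewrite IH negbK; have -> : (c == ~~ c) = false by case: (c).
  by case: (alternating c s); case: (alternating _ s).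
rewrite big1 //; have -> : (x == ~~ c) by case: (x) (c) xc => -[].
by rewrite addbF.
Qed.

(* The label [m] stands for the signed index [(-1)^m (m./2 + 1)]. *)
Definition flip (m : nat) : nat := ((m./2).*2 + ~~ odd m)%N.

Lemma odd_flip m : odd (flip m) = ~~ odd m.
Proof. by rewrite /flip oddD odd_double; case: (odd m). Qed.

Definition no_compl (l : seq nat) :=
  {in l &, forall x y, x./2 = y./2 -> x = y}.

(** Sorting with [leq] orders labels by absolute index, as in Ky Fan's alternation; [c] is the sign
    of the smallest label, [true] being negative. *)
Definition alt_labels (c : bool) (l : seq nat) :=
  alternating c (map odd (sort leq l)).

Lemma alt_labels_perm c l l' : perm_eq l l' -> alt_labels c l = alt_labels c l'.
Proof.
move=> ll'; congr (alternating c (map odd _)).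
by apply/perm_sortP => //; [exact: leq_total|exact: leq_trans|exact: anti_leq].
Qed.

(* Ky Fan's parity argument: an alternating simplex has exactly one facet that
   alternates starting from the sign [c], any other simplex has 0 or 2. *)
Lemma alt_labels_bd c l :
  \big[addb/false]_(t <- bd l) alt_labels c t =
  alt_labels c l (+) alt_labels (~~ c) l.
Proof.
have p : perm_eq l (sort leq l) by rewrite perm_sym perm_sort.
rewrite (big_bd_perm (@alt_labels_perm c) p) -alternating_bd bd_map big_map.
apply: eq_big_seq => t /bd_subseq ts.
rewrite /alt_labels sorted_sort//; first exact: leq_trans.
apply: (subseq_sorted leq_trans ts); exact: sort_sorted leq_total _.
Qed.

(** [flip] keeps the half of a label, so in the absence of opposite labels it preserves the order on
    [l], commutes with sorting and only negates the parities. *)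
Lemma alt_labels_flip c l : no_compl l ->
  alt_labels c (map flip l) = alt_labels (~~ c) l.
Proof.
move=> nc.
have -> : alt_labels c (map flip l) = alternating c (map odd (map flip (sort leq l))).
  congr (alternating c (map odd _)).
  apply: (sorted_eq leq_trans anti_leq); first exact: sort_sorted leq_total _.
    rewrite sorted_map.
    apply: (@sub_in_sorted _ (mem l) leq); last exact: sort_sorted leq_total _.
      move=> x y xl yl xy /=; rewrite /flip.
      have := half_leq xy; rewrite leq_eqVlt => /orP[/eqP /nc ->//|h].
      rewrite (leq_trans (n := (y./2).*2))// ?leq_addr//.
      by rewrite (leq_trans (n := (x./2.+1).*2))// ?leq_double// doubleS; case: (odd x); lia.
    by apply/allP => x; rewrite mem_sort.
  by rewrite perm_sort perm_map// perm_sym perm_sort.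
rewrite /alt_labels -alternating_negb -!map_comp; congr (alternating c _).
by apply: eq_map => x /=; rewrite odd_flip.
Qed.

(** Consecutive sorted labels have opposite signs and so cannot share an index: the indices increase
    strictly below [j]. *)
Lemma alt_labels_size c l j : no_compl l -> alt_labels c l ->
  (forall x, x \in l -> (x./2 < j)%N) -> (size l <= j)%N.
Proof.
move=> nc al lj.
have : sorted ltn (map half (sort leq l)).
  have : {subset sort leq l <= l} by move=> x; rewrite mem_sort.
  move: al (sort_sorted leq_total l); rewrite /alt_labels.
  elim: (sort leq l) c => [|x [|y s] IH]// c /= /and3P[xc yc al] /andP[xy ss] sl.
  apply/andP; split; last first.
    apply: (IH (~~ c)) => //; first by rewrite /= yc al.
    by move=> z zs; apply: sl; rewrite inE zs orbT.
  rewrite ltn_neqAle half_leq// andbT; apply/eqP => /nc e.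
  move: xc yc; rewrite e ?sl ?inE ?eqxx ?orbT//.
  by case: (odd y) (c) => -[].
move=> /(sorted_uniq ltn_trans ltnn) u.
rewrite -(size_sort leq) -(size_map half) -(size_iota 0 j).
apply: uniq_leq_size => // _ /mapP[x + ->].
by rewrite mem_sort mem_iota add0n => /lj.
Qed.

(** * Iterated barycentric subdivision of chains *)

Section Barycentric.
Context {R : realType} {V : normedModType R}.
Implicit Types (s t : seq V) (c : seq (seq V)).

Definition bary s : V := (size s)%:R^-1 *: \sum_(v <- s) v.

(** The fuel [k] is meant to be the size of [s]; each simplex then lists the barycentres of a
    descending flag of faces of [s]. *)
Fixpoint sd (k : nat) s : seq (seq V) :=
  if k is k'.+1 then [seq bary s :: t | t <- flatten [seq sd k' u | u <- bd s]]
  else [:: s].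

(** Deleting the barycentre leaves the subdivided facets; the faces that keep it are cones over the
    subdivision of the boundary of the boundary, and cancel. *)
Lemma bd_sd (f : seq V -> bool) k s :
  \big[addb/false]_(t <- sd k.+1 s) \big[addb/false]_(u <- bd t) f u =
  \big[addb/false]_(u <- bd s) \big[addb/false]_(t <- sd k u) f t.
Proof.
elim: k f s => [|k IH] f s.
  rewrite /= big_map; under eq_bigr do rewrite /= big_cons big_map.
  rewrite big_split /= !big_flatten !big_map.
  rewrite [X in _ (+) X](_ : _ = false) ?addbF//.
  by under eq_bigr do rewrite big_seq1; exact: (bd_bd (fun u => f (bary s :: u))).
rewrite [sd k.+2 s]/= big_map.
under eq_bigr do rewrite /= big_cons big_map.
rewrite big_split big_flatten big_map /= big_flatten big_map.
rewrite [X in _ (+) X](_ : _ = false) ?addbF//.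
under eq_bigr => u _.
  have := IH (fun v => f (bary s :: v)) u; rewrite /= => ->; over.
exact: bd_bd.
Qed.

Lemma baryN s : bary (map -%R s) = - bary s.
Proof. by rewrite /bary size_map big_map sumrN scalerN. Qed.

Lemma sdN k s : sd k (map -%R s) = map (map -%R) (sd k s).
Proof.
elim: k s => //= k IH s; rewrite bd_map baryN -map_comp.
rewrite (_ : [seq _ | u <- bd s] = [seq map (map -%R) (sd k u) | u <- bd s]); last first.
  by apply: eq_map => u /=; rewrite IH.
rewrite (map_comp (map (map -%R)) (sd k)) -map_flatten -!map_comp.
exact: eq_map.
Qed.

Definition sdc k c := flatten [seq sd k s | s <- c].

Definition bounds c d := forall f : seq V -> bool,
  \big[addb/false]_(t <- c) \big[addb/false]_(u <- bd t) f u =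
  \big[addb/false]_(t <- d) f t.

Lemma sdc_bounds k c d : bounds c d -> bounds (sdc k.+1 c) (sdc k d).
Proof.
move=> cd f; rewrite !big_flatten !big_map.
by under eq_bigr do rewrite bd_sd; rewrite cd.
Qed.

Definition oppc c := map (map -%R) c.

Lemma iter_sdc_sym k N c :
  iter N (sdc k) (c ++ oppc c) = iter N (sdc k) c ++ oppc (iter N (sdc k) c).
Proof.
elim: N => //= N ->; rewrite /sdc map_cat flatten_cat; congr cat.
rewrite /oppc map_flatten -!map_comp; congr flatten.
by apply: eq_map => u /=; rewrite sdN.
Qed.

Lemma iter_sdc_bounds k N c d : bounds c d ->
  bounds (iter N (sdc k.+1) c) (iter N (sdc k) d).
Proof. by move=> cd; elim: N => //= N; exact: sdc_bounds. Qed.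

(** Convexity, in the only form that subdivision uses. *)
Definition avg_closed (P : V -> Prop) :=
  forall s, s != [::] -> (forall v, v \in s -> P v) -> P (bary s).

Lemma sd_hull (P : V -> Prop) k s : avg_closed P -> size s = k ->
    (forall v, v \in s -> P v) ->
  forall t, t \in sd k s -> size t = k /\ forall v, v \in t -> P v.
Proof.
move=> Pa; elim: k s => [|k IH] s sk sP t /=.
  by rewrite inE => /eqP ->.
move=> /mapP[t' /flatten_mapP[u us tu] ->].
have [||h1 h2] := IH u _ _ _ tu; first by have := size_bd us; rewrite sk => -[].
  by move=> v vu; apply: sP; exact: (mem_subseq (bd_subseq us)).
split; first by rewrite /= h1.
move=> v; rewrite inE => /orP[/eqP ->|/h2//].
by apply: Pa => //; rewrite -size_eq0 sk.
Qed.

Lemma bary_sub s (z : V) : s != [::] ->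
  bary s - z = (size s)%:R^-1 *: \sum_(v <- s) (v - z).
Proof.
move=> s0; rewrite big_split /= scalerDr; congr (_ + _).
have -> : \sum_(v <- s) - z = (size s)%:R *: - z.
  by rewrite big_const_seq count_predT iter_addr_0 scaler_nat.
rewrite scalerA mulVf ?scale1r//.
by rewrite pnatr_eq0 size_eq0.
Qed.

Lemma ball_avg_closed (z : V) r : avg_closed (fun x => `|x - z| <= r).
Proof.
move=> s s0 sP; rewrite bary_sub// normrZ ger0_norm ?invr_ge0//.
have s1 : 0 < (size s)%:R :> R by rewrite ltr0n lt0n size_eq0.
rewrite ler_pdivrMl// (le_trans (ler_norm_sum _ _ _))//.
rewrite mulr_natl -[X in _ *+ X]count_predT -iter_addr_0 -big_const_seq.
by rewrite big_seq [leRHS]big_seq; apply: ler_sum => v vs; exact: sP.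
Qed.

(** In the average defining the difference of [bary s] and a vertex [v], the term of [v] itself is
    zero, which saves a factor [1 - 1 / size s]; [n] bounds all sizes and makes the factor uniform.
    Pairs avoiding [bary s] lie in a subdivided facet. *)
Lemma sd_diam k s n (D : R) : (k <= n)%N -> size s = k -> 0 <= D ->
    (forall x y, x \in s -> y \in s -> `|x - y| <= D) ->
  forall t, t \in sd k s -> forall x y, x \in t -> y \in t ->
  `|x - y| <= (1 - n.+1%:R^-1) * D.
Proof.
move=> kn sk D0; elim: k s kn sk => [|k IH] s kn sk sD t /=.
  by rewrite inE (size0nil sk) => /eqP ->.
move=> /mapP[t' /flatten_mapP[u us tu] ->].
have n1 : 0 <= 1 - n.+1%:R^-1 :> R by rewrite subr_ge0 invf_le1// ler1n.
have us' : {subset u <= s} := mem_subseq (bd_subseq us).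
have uk : size u = k by have := size_bd us; rewrite sk => -[].
have s0 : s != [::] by rewrite -size_eq0 sk.
(* A ball around [bary s] is closed under averages, so only the vertices of the facet [u] have to be
   tested. *)
have ht : forall x, x \in t' -> `|x - bary s| <= (1 - n.+1%:R^-1) * D.
  have [|_ ] := sd_hull (@ball_avg_closed (bary s) ((1 - n.+1%:R^-1) * D)) uk _ tu; last by [].
  move=> v vu; rewrite distrC bary_sub// normrZ ger0_norm ?invr_ge0//.
  have vs := us' _ vu.
  rewrite sk ler_pdivrMl// (le_trans (ler_norm_sum _ _ _))//.
  rewrite (perm_big _ (perm_to_rem vs)) big_cons /= subrr normr0 add0r.
  apply: (@le_trans _ _ (k%:R * D)).
    have <- : size (rem v s) = k by rewrite size_rem// sk.
    rewrite mulr_natl -[X in _ *+ X]count_predT -iter_addr_0 -big_const_seq.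
    rewrite big_seq [leRHS]big_seq; apply: ler_sum => x xs; apply: sD => //.
    exact: mem_rem xs.
  rewrite mulrA ler_wpM2r// mulrBr mulr1 -[X in _ <= X - _]natr1.
  by rewrite -addrA lerDl subr_ge0 ler_pdivrMr// mul1r ler_nat ltnW.
move=> x y; rewrite !inE => /orP[/eqP ->|xt] /orP[/eqP ->|yt].
- by rewrite subrr normr0 mulr_ge0.
- by rewrite distrC; exact: ht.
- exact: ht.
- apply: (IH u _ uk _ t' tu) => //; first exact: ltnW.
  by move=> a b au bu; apply: sD; exact: us'.
Qed.

End Barycentric.

(** * The cross-polytope *)

Section CrossPolytope.
Context {R : realType} {n : nat}.
Implicit Types (s t : seq 'rV[R]_n) (x : 'rV[R]_n).

Definition unit_row (k : nat) : 'rV[R]_n := \row_i (i == k :> nat)%:R.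

(* The full boundary of the cross-polytope spanned by the first [k] axes: the
   join of the previous one with the two vertices of the new axis. *)
Fixpoint cross (k : nat) : seq (seq 'rV[R]_n) :=
  if k is k'.+1 then
    let h := map (cons (unit_row k')) (cross k') in h ++ oppc h
  else [:: [::]].

Lemma cross_sym (f : seq 'rV[R]_n -> bool) k :
  \big[addb/false]_(s <- cross k) f (map -%R s) =
  \big[addb/false]_(s <- cross k) f s.
Proof.
case: k => [|k] /=; first by rewrite !big_seq1.
rewrite !big_cat /= /oppc !big_map addbC; congr addb.
by apply: eq_bigr => s _; rewrite -map_comp; congr f; rewrite /= opprK (eq_map opprK) map_id.
Qed.

Lemma bounds_cone (e : 'rV[R]_n) (c : seq (seq 'rV[R]_n)) :
    (forall f : seq 'rV[R]_n -> bool,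
      \big[addb/false]_(s <- c) \big[addb/false]_(u <- bd s) f u = false) ->
  bounds (map (cons e) c) c.
Proof.
move=> c0 f; rewrite big_map; under eq_bigr do rewrite /= big_cons big_map.
by rewrite big_split /= (c0 (fun u => f (e :: u))) addbF.
Qed.

(** The cones with apices [unit_row k] and its opposite have as boundaries [cross k] and its
    antipode, which are the same chain modulo 2. *)
Lemma cross_closed k (f : seq 'rV[R]_n -> bool) :
  \big[addb/false]_(s <- cross k) \big[addb/false]_(u <- bd s) f u = false.
Proof.
elim: k f => [|k IH] f; first by rewrite big_seq1 big_nil.
have b := bounds_cone (unit_row k) IH.
rewrite /= big_cat /= b [X in _ (+) X]big_map.
under [X in _ (+) X]eq_bigr do rewrite bd_map big_map.
by rewrite (b (fun u => f (map -%R u))) cross_sym addbb.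
Qed.

(** The compact region between the unit spheres of the l1 norm and of the sup norm. It avoids the
    origin and contains all vertices of the subdivided cross-polytope. *)
Definition shell : set 'rV[R]_n :=
  [set x : 'rV[R]_n | `|x| <= 1 /\ 1 <= \sum_i `|x ord0 i|].

(** For a sign vector [e] the equation is that of the hyperplane of a facet: being affine it
    survives averages, and it forces the l1 norm to be at least 1. *)
Definition on_face (e : 'cV[R]_n) x := `|x| <= 1 /\ x *m e = 1%:M.

Lemma on_face_avg e : avg_closed (on_face e).
Proof.
move=> s s0 sP; split.
  rewrite -[bary s]subr0; apply: ball_avg_closed => // v /sP[]; rewrite subr0//.
rewrite /bary -scalemxAl mulmx_suml.
rewrite big_seq; under eq_bigr => v vs do rewrite (proj2 (sP _ vs)).
rewrite -big_seq big_const_seq count_predT iter_addr_0 -[X in _ *: X]scaler_nat scalerA.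
by rewrite mulVf ?scale1r// pnatr_eq0 size_eq0.
Qed.

Lemma on_face_shell (e : 'cV[R]_n) x : (forall i, `|e i ord0| = 1) -> on_face e x -> shell x.
Proof.
move=> e1 [x1 xe]; split => //.
have := congr1 (fun A : 'M[R]_1 => `|A ord0 ord0|) xe.
rewrite !mxE /= mulr1n normr1 => E; rewrite -[leLHS]E.
rewrite (le_trans (ler_norm_sum _ _ _))//; apply: ler_sum => i _.
by rewrite normrM e1 mulr1.
Qed.

Lemma row_norm_le x (r : R) : 0 <= r -> (`|x| <= r) <-> (forall i, `|x ord0 i| <= r).
Proof.
move=> r0; rewrite /Num.Def.normr /= mx_normrE; split.
  by move=> + i; apply: le_trans; apply: (@le_bigmax _ _ _ _ (fun ij => `|x ij.1 ij.2|) (ord0, i)).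
move=> xr; apply: bigmax_le => // -[i j] _ /=; by rewrite ord1 xr.
Qed.

Lemma cross_face k s : (k <= n)%N -> s \in cross k ->
  [/\ size s = k, (forall x, x \in s -> forall i : 'I_n, (k <= i)%N -> x ord0 i = 0)
    & exists2 e : 'cV[R]_n, (forall i, `|e i ord0| = 1) &
        forall x, x \in s -> on_face e x].
Proof.
elim: k s => [|k IH] s kn.
  rewrite inE => /eqP ->; split => //.
  by exists (const_mx 1) => // i; rewrite mxE normr1.
wlog: s / s \in map (cons (unit_row k)) (cross k).
  move=> H; rewrite [cross _]/= mem_cat => /orP[sh|/mapP[t th ->]].
    by apply: H => //=; rewrite mem_cat sh.
  have [||ts t0 [e e1 et]] := H t; rewrite //= ?mem_cat ?th//.
  split; first by rewrite size_map.
    by move=> _ /mapP[x xt ->] i ki; rewrite mxE t0// oppr0.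
  exists (- e) => [i|_ /mapP[x /et[x1 xe] ->]]; first by rewrite mxE normrN.
  by split; rewrite ?normrN// mulmxN mulNmx opprK.
move=> /mapP[t tc ->] _.
have [ts t0 [e e1 et]] := IH t (ltnW kn) tc.
split; first by rewrite /= ts.
  move=> x; rewrite inE => /orP[/eqP ->|/t0 xt] i ki; last by rewrite xt// ltnW.
  by rewrite mxE gtn_eqF.
(* The vertices of [t] vanish at coordinate [k], so its sign can be reset to 1. *)
exists (\col_i if i == k :> nat then 1 else e i ord0).
  by move=> i; rewrite mxE; case: ifP; rewrite ?normr1.
move=> x; rewrite inE => /orP[/eqP ->|xt].
  split.
    apply/(row_norm_le _ ler01) => i; rewrite mxE normr_nat lern1; exact: leq_b1.
  apply/matrixP => a b; rewrite !ord1 !mxE (bigD1 (Ordinal kn))//.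
  rewrite !mxE /= !eqxx mulr1.
  rewrite big1 ?addr0// => i ik; rewrite !mxE.
  have /negPf -> : (i != k :> nat) by apply: contra ik => /eqP ik'; apply/eqP/val_inj.
  by rewrite mul0r.
have [x1 xe] := et _ xt; split=> //; rewrite -xe.
apply/matrixP => a b; rewrite !ord1 !mxE; apply: eq_bigr => i _; rewrite !mxE.
by case: eqP => // ik; rewrite t0 ?mul0r// ik.
Qed.

Let q : R := 1 - n.+1%:R^-1.

Lemma subdivided_cross k N s : (k <= n)%N -> s \in iter N (sdc k) (cross k) ->
  [/\ size s = k, (forall x, x \in s -> shell x) &
      forall x y, x \in s -> y \in s -> `|x - y| <= q ^+ N * 2].
Proof.
move=> kn sN.
have q0 : 0 <= q by rewrite subr_ge0 invf_le1// ler1n.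
suff [sk [e e1 es] sD] : [/\ size s = k,
    exists2 e : 'cV[R]_n, (forall i, `|e i ord0| = 1) &
        (forall x, x \in s -> on_face e x) &
      forall x y, x \in s -> y \in s -> `|x - y| <= q ^+ N * 2].
  by split=> // x /es; exact: on_face_shell.
elim: N s sN => [|N IH] s.
  move=> /(cross_face kn)[sk s0 [e e1 es]]; split=> //; first by exists e.
  move=> x y /es[x1 _] /es[y1 _]; rewrite expr0 mul1r (le_trans (ler_normB _ _))//.
  by rewrite -[2]/(1 + 1) lerD.
rewrite iterS => /flatten_mapP[t /IH[tk [e e1 et] tD] st].
have [sk es] := sd_hull (@on_face_avg e) tk et st.
split=> //; first by exists e.
by rewrite exprS -mulrA; apply: (sd_diam kn tk _ tD st); rewrite mulr_ge0// exprn_ge0.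
Qed.

(** At a mesh that rules out opposite labels on a simplex, every subdivided sphere has an odd number
    of simplices alternating from [true]; one of full size carries [n] distinct indices below
    [j]. *)
Lemma fan_labels (lab : 'rV[R]_n -> nat) (j N : nat) :
    (forall x, shell x -> lab (- x) = flip (lab x)) ->
    (forall x, shell x -> ((lab x)./2 < j)%N) ->
    (forall x y, shell x -> shell y -> `|x - y| <= q ^+ N * 2 ->
       (lab x)./2 = (lab y)./2 -> lab x = lab y) ->
  (n <= j)%N.
Proof.
move=> labN labj labnc.
have nc k s : (k <= n)%N -> s \in iter N (sdc k) (cross k) -> no_compl (map lab s).
  move=> kn /(subdivided_cross kn)[_ sK sD].
  by move=> _ _ /mapP[x xs ->] /mapP[y ys ->]; apply: labnc; [exact: sK..|exact: sD].
pose phi s := alt_labels true (map lab s).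
suff odd_count k : (k <= n)%N ->
    \big[addb/false]_(s <- iter N (sdc k) (cross k)) phi s = true.
  have [/hasP[s sN ps]|/hasPn none] := boolP (has phi (iter N (sdc n) (cross n))).
    have [sn sK _] := subdivided_cross (leqnn n) sN.
    rewrite -[leqLHS]sn -(size_map lab); apply: alt_labels_size ps _.
      exact: nc sN.
    by move=> _ /mapP[x /sK /labj ? ->].
  have := odd_count n (leqnn n); rewrite big_seq big1// => s /none.
  by move/negPf.
elim: k => [_|k IH kn].
  (* The only simplex is the empty one, and it alternates. *)
  have -> : iter N (sdc 0) (cross 0) = [:: [::]] by elim: (N) => //= M ->.
  by rewrite big_seq1 /phi /alt_labels.
have /= sN := @subdivided_cross k.+1 N ^~ kn.
have /= ncN := @nc k.+1 ^~ kn.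
move: sN ncN; rewrite iter_sdc_sym; set h := iter _ _ _ => sN ncN.
(* The chain [h] is a subdivided hemisphere. Together [s] and its antipode count the alternations of
   [s] from either sign, that is, modulo 2, the facets of [s] alternating from [true]; summed over
   [h] these leave its boundary, the previous sphere. *)
rewrite big_cat /= /oppc [X in _ (+) X]big_map -big_split /=.
rewrite -[RHS](IH (ltnW kn)) -(iter_sdc_bounds k N (bounds_cone (unit_row k) (@cross_closed k))).
rewrite -/h; apply: eq_big_seq => s sh.
rewrite /phi.
have sh' : s \in h ++ oppc h by rewrite mem_cat sh.
have [_ sK _] := sN _ sh'.
have -> : map lab (map -%R s) = map flip (map lab s).
  by rewrite -!map_comp; apply/eq_in_map => x xs /=; rewrite labN//; exact: sK.
by rewrite (alt_labels_flip _ (ncN _ sh')) -alt_labels_bd bd_map big_map.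
Qed.

End CrossPolytope.

(** * The Borsuk-Ulam theorem *)

Lemma continuous_sum {T : topologicalType} {R : realType} {I : Type} (r : seq I)
    (P : pred I) (f : I -> T -> R) :
  (forall i, P i -> continuous (f i)) -> continuous (fun x => \sum_(i <- r | P i) f i x).
Proof.
move=> fc; elim: r => [|i r IH] x.
  by under eq_fun do rewrite big_nil; exact: cvg_cst.
under eq_fun do rewrite big_cons.
by case: ifP => Pi; [apply: cvgD; [exact: fc|exact: IH]|exact: IH].
Qed.

Section BorsukUlam.
Context {R : realType} {n : nat}.
Implicit Types x y : 'rV[R]_n.

Lemma continuous_l1norm : continuous (fun x => \sum_i `|x ord0 i|).
Proof.
apply: continuous_sum => i _ x.
apply: (@continuous_comp _ _ _ (fun y : 'rV[R]_n => y ord0 i) Num.norm).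
  exact: coord_continuous.
exact: norm_continuous.
Qed.

Lemma compact_shell : compact (@shell R n).
Proof.
apply: bounded_closed_compact.
  by exists 1; split; rewrite ?num_real// => M M1 x [x1 _] /=; rewrite (le_trans x1)// ltW.
have -> : @shell R n = (fun x => `|x|) @^-1` [set r | r <= 1] `&`
    (fun x => \sum_i `|x ord0 i|) @^-1` [set r | 1 <= r] by [].
apply: closedI.
- by apply: (iffLR (continuous_closedP _)); [exact: norm_continuous|exact: closed_le].
- by apply: (iffLR (continuous_closedP _)); [exact: continuous_l1norm|exact: closed_ge].
Qed.

Lemma within_shell_unif j (G : 'rV[R]_n -> 'rV[R]_j) (e : R) :
    {within shell, continuous G} -> 0 < e ->
  exists2 d : R, 0 < d & forall x y, shell x -> shell y -> `|x - y| < d ->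
    `|G x - G y| < e.
Proof.
move=> /subspace_continuousP cG e0.
pose P (d : R) x := shell x -> forall y, shell y -> `|x - y| < d -> `|G x - G y| < e.
have : \forall d \near (0:R)^'+, shell `<=` P d.
  apply: (iffLR (compact_near_coveringP _) compact_shell) => x sx.
  have e2 : 0 < e / 2 by rewrite divr_gt0.
  move/cvgrPdist_lt: (cG x sx) => /(_ _ e2).
  rewrite near_withinE => /nbhs_ballP[r /= r0 xr].
  have r2 : 0 < r / 2 by rewrite divr_gt0.
  exists (ball x (r / 2), [set d | d < r / 2]).
    split => /=; first exact: nbhsx_ballx.
    exact: nbhs_right_lt.
  move=> [x' d] [/= xx' dr] sx' y sy x'y.
  rewrite (splitr e) -(subrKA (G x)) addrC (le_lt_trans (ler_normD _ _))//.
  move: xx'; rewrite -ball_normE /= => xx'.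
  apply: ltrD.
    apply: xr => //; rewrite -ball_normE /= -(subrKA x').
    rewrite (splitr r) (le_lt_trans (ler_normD _ _))// ltrD//.
    exact: lt_trans dr.
  rewrite distrC; apply: xr => //; rewrite -ball_normE /= (lt_trans xx')//.
  by rewrite ltr_pdivrMr// ltr_pMr// ltr1n.
move=> H.
have [d [d0 dP]] : exists d : R, 0 < d /\ shell `<=` P d.
  near (0:R)^'+ => d; exists d; split; last by near: d.
  by near: d; exact: nbhs_right_gt.
by exists d => // x y sx; exact: dP.
Unshelve. all: by end_near. Qed.

(** A point [x] is labelled by an index where the modulus of the coordinate of [G x] reaches the
    minimum [eta] of the norm, and by the sign there. The choice depends on moduli only, so
    antipodes get opposite labels; at close points, opposite labels would put values [2 * eta]
    apart. *)
Theorem borsuk_ulam j (G : 'rV[R]_n -> 'rV[R]_j) :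
    {within shell, continuous G} ->
    (forall x, shell x -> G (- x) = - G x) ->
    (forall x, shell x -> G x != 0) ->
  (n <= j)%N.
Proof.
move=> cG GN G0.
have [n0|n0] := posnP n; first by rewrite n0.
have shell0 : @shell R n !=set0.
  exists (unit_row 0); split.
    by apply/(row_norm_le _ ler01) => i; rewrite mxE normr_nat lern1; exact: leq_b1.
  by rewrite (bigD1 (Ordinal n0))//= mxE /= normr1 lerDl sumr_ge0.
have cnG : {within shell, continuous (fun x => `|G x|)}.
  by move=> x; apply: cvg_norm; exact: cG.
have [c cs cmin] := EVT_min_rV shell0 compact_shell cnG.
set eta := `|G c| in cmin.
have eta0 : 0 < eta by rewrite normr_gt0; apply: G0; rewrite inE in cs.
have big_coord x : shell x -> exists i, eta <= `|G x ord0 i|.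
  move=> sx; have Gx := cmin x; rewrite inE in Gx; have {}Gx := Gx sx.
  have : mx_norm (G x) != 0.
    by have := G0 x sx; rewrite -normr_gt0 => /lt0r_neq0.
  by move=> /mx_norm_neq0[[a i]] /= E; exists i; rewrite ord1 in E; rewrite -E.
have [d d0 dP] := within_shell_unif cG eta0.
pose q : R := 1 - n.+1%:R^-1.
have [N qN] : exists N, q ^+ N * 2 < d.
  have q1 : `|q| < 1.
    by rewrite ger0_norm ?ltrBlDr ?ltrDl ?invr_gt0// subr_ge0 invf_le1// ler1n.
  have d2 : 0 < d / 2 by rewrite divr_gt0.
  move/cvgrPdist_lt: (cvg_expr q1) => /(_ _ d2) [N _ /(_ N (leqnn N))].
  rewrite /= sub0r normrN => /(le_lt_trans (ler_norm _)) qN; exists N.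
  by rewrite -ltr_pdivlMr.
pose pk x := [pick i | eta <= `|G x ord0 i|].
(* On the shell [pk] always succeeds, so the default [0] never occurs there. *)
pose lab x : nat := if pk x is Some i then ((G x ord0 i < 0)%R + i.*2)%N else 0.
have labE x : shell x -> exists i, [/\ pk x = Some i, eta <= `|G x ord0 i| &
    lab x = ((G x ord0 i < 0)%R + i.*2)%N].
  move=> sx; rewrite /lab /pk; case: pickP => [i ei|none]; first by exists i.
  by have [i] := big_coord x sx; rewrite none.
apply: (@fan_labels R n lab j N).
- move=> x sx; have [i [pi ei ->]] := labE x sx.
  rewrite /lab; have -> : pk (- x) = pk x.
    by apply: eq_pick => k; rewrite GN// mxE normrN.
  rewrite pi /flip half_bit_double oddD odd_double addbF oddb addnC GN// mxE.
  rewrite oppr_lt0; case: ltgtP => // E.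
  by move: ei; rewrite -E normr0 leNgt eta0.
- by move=> x sx; have [i [_ _ ->]] := labE x sx; rewrite half_bit_double.
- move=> x y sx sy xy.
  have [i [_ ei ->]] := labE x sx; have [k [_ ek ->]] := labE y sy.
  rewrite !half_bit_double => /val_inj ik; subst k.
  congr (nat_of_bool _ + _)%N.
  have := dP x y sx sy (le_lt_trans xy qN) => GG.
  have : `|G x ord0 i - G y ord0 i| < eta.
    apply: le_lt_trans GG.
    have := iffLR (row_norm_le (G x - G y) (normr_ge0 _)) (lexx _) i.
    by rewrite !mxE.
  move: ei ek; rewrite ltr_norml !ler_normr => /orP[] h1 /orP[] h2 /andP[h3 h4];
    case: ltP => h5; case: ltP => h6 //; lra.
Qed.

End BorsukUlam.

(** * The spectral theorem for real symmetric matrices *)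

Section Spectral.
Context {R : realType}.

Definition qform {m} (A : 'M[R]_m) (g : 'rV[R]_m) : R :=
  \sum_i \sum_j g ord0 i * A i j * g ord0 j.

Definition wnorm {m} (mu : 'I_m -> R) (g : 'rV[R]_m) : R :=
  \sum_i mu i * g ord0 i ^+ 2.

Lemma qformE m (A : 'M[R]_m) g : g *m A *m g^T = (qform A g)%:M.
Proof.
apply/matrixP => a b; rewrite !ord1 !mxE /= mulr1n /qform [RHS]exchange_big /=.
by apply: eq_bigr => i _; rewrite !mxE mulr_suml.
Qed.

Lemma wnormE m (mu : 'I_m -> R) g :
  g *m diag_mx (\row_i mu i) *m g^T = (wnorm mu g)%:M.
Proof.
apply/matrixP => a b; rewrite !ord1 !mxE /= mulr1n.
by apply: eq_bigr => i _; rewrite mul_mx_diag !mxE expr2 mulrCA mulrA.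
Qed.

Lemma wnorm_ge0 m (mu : 'I_m -> R) g : (forall i, 0 <= mu i) -> 0 <= wnorm mu g.
Proof. by move=> mu0; apply: sumr_ge0 => i _; rewrite mulr_ge0// sqr_ge0. Qed.

Lemma scalar_mx1_inj (a b : R) : a%:M = b%:M :> 'M[R]_1 -> a = b.
Proof. by move=> /matrixP /(_ ord0 ord0); rewrite !mxE. Qed.

Lemma continuous_qform m (A : 'M[R]_m) : continuous (qform A).
Proof.
have c k : continuous (fun g : 'rV[R]_m => g ord0 k) by exact: coord_continuous.
apply: continuous_sum => i _; apply: continuous_sum => j _ x.
exact: (cvgM (cvgM (c i x) (cvg_cst _)) (c j x)).
Qed.

Lemma qformZ m (A : 'M[R]_m) a g : qform A (a *: g) = a ^+ 2 * qform A g.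
Proof.
rewrite /qform mulr_sumr; apply: eq_bigr => i _; rewrite mulr_sumr.
by apply: eq_bigr => j _; rewrite !mxE; ring.
Qed.

Lemma qform_line m (A : 'M[R]_m) g u t : A^T = A ->
  qform A (g + t *: u) =
  qform A g + t * (2 * (u *m A *m g^T) ord0 ord0) + t ^+ 2 * qform A u.
Proof.
move=> As; apply: scalar_mx1_inj.
have gu : g *m A *m u^T = u *m A *m g^T.
  have <- : (g *m A *m u^T)^T = u *m A *m g^T by rewrite !trmx_mul trmxK As mulmxA.
  by apply/matrixP => a b; rewrite !ord1 [RHS]mxE.
rewrite -qformE [(g + _)^T]raddfD /= [(t *: u)^T]linearZ /=.
rewrite mulmxDl -scalemxAl mulmxDr !mulmxDl -!scalemxAr -!scalemxAl gu !qformE.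
apply/matrixP => a b; rewrite !ord1 !mxE /= !mulr1n; ring.
Qed.

(** If [u = g *m A] were nonzero, a small step from [g] along [- u] would make the form negative,
    its linear term being negative and its value at [g] zero. *)
Lemma psd_kernel m (A : 'M[R]_m) g : A^T = A -> (forall u, 0 <= qform A u) ->
  qform A g = 0 -> g *m A = 0.
Proof.
move=> As A0 g0; have [u gA] : exists u, g *m A = u by exists (g *m A).
rewrite gA.
have uu : (u *m A *m g^T) ord0 ord0 = \sum_i u ord0 i ^+ 2.
  rewrite -mulmxA -[X in X *m g^T]As -trmx_mul gA mxE; apply: eq_bigr => i _.
  by rewrite mxE expr2.
have a0 : 0 <= \sum_i u ord0 i ^+ 2 by apply: sumr_ge0 => i _; exact: sqr_ge0.
move: a0; rewrite le_eqVlt => /orP[/eqP/esym/eqP|a0].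
  rewrite psumr_eq0 => [/allP ui|i _]; last exact: sqr_ge0.
  apply/rowP => i; rewrite mxE; apply/eqP; rewrite -sqrf_eq0.
  by apply: (ui i); rewrite mem_index_enum.
exfalso; set a := \sum_i _ in a0 uu.
have b0 := A0 u; set b := qform A u in b0.
(* The step length is near the minimiser [a / b]; the added 1 covers [b = 0]. *)
have := A0 (g + (- (a / (b + 1))) *: u); rewrite qform_line// g0 uu add0r -/b.
have b1 : 0 < b + 1 by rewrite ltr_wpDl.
have -> : - (a / (b + 1)) * (2 * a) + (- (a / (b + 1))) ^+ 2 * b =
    - (a ^+ 2 * (b + 2)) / (b + 1) ^+ 2 by field; rewrite lt0r_neq0.
rewrite leNgt => /negP; apply.
by rewrite mulNr oppr_lt0 divr_gt0// ?exprn_gt0// mulr_gt0// ?exprn_gt0// ltr_wpDl.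
Qed.

(** Let [v] maximise the form on the unit sphere, with maximum [l]. Then [l%:M - S] is positive
    semidefinite and its form vanishes at [v], so [v] lies in its kernel. *)
Lemma sym_eigenvector n (S : 'M[R]_n.+1) : S^T = S ->
  exists (v : 'rV[R]_n.+1) (l : R), v *m S = l *: v /\ v *m v^T = 1%:M.
Proof.
move=> Ss.
pose K := [set v : 'rV[R]_n.+1 | qform 1%:M v = 1].
have sq (v : 'rV[R]_n.+1) : qform 1%:M v = \sum_i v ord0 i ^+ 2.
  apply: scalar_mx1_inj; rewrite -qformE mulmx1; apply/matrixP => a b.
  by rewrite !ord1 !mxE /= mulr1n; apply: eq_bigr => i _; rewrite mxE expr2.
have K0 : K !=set0.
  exists (delta_mx 0 0); rewrite /K /= sq (bigD1 ord0)//= mxE !eqxx /= expr1n.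
  by rewrite big1 ?addr0// => i i0; rewrite mxE (negPf i0) andbF expr0n.
have Kc : compact K.
  apply: bounded_closed_compact.
    exists 1; split; rewrite ?num_real// => M M1 v Kv /=.
    rewrite (le_trans _ (ltW M1))//; apply/(row_norm_le _ ler01) => i.
    rewrite -[leRHS]normr1 -ler_sqr ?nnegrE//.
    rewrite -!normrX expr1n normr1 ger0_norm ?sqr_ge0// -Kv sq.
    by rewrite (bigD1 i)//= lerDl sumr_ge0// => j _; exact: sqr_ge0.
  have -> : K = qform 1%:M @^-1` [set 1] by [].
  apply: (iffLR (continuous_closedP _)); first exact: continuous_qform.
  exact: closed_eq.
have [v vK vmax] := EVT_max_rV K0 Kc (continuous_subspaceT (@continuous_qform _ S)).
rewrite inE in vK; exists v, (qform S v).
set l := qform S v; split; last by have := qformE 1%:M v; rewrite mulmx1 vK.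
have qB u : qform (l%:M - S) u = l * qform 1%:M u - qform S u.
  apply: scalar_mx1_inj; rewrite -qformE mulmxBr mulmxBl [u *m S *m _]qformE raddfB /=; congr (_ - _).
  have := qformE 1%:M u; rewrite mulmx1 mul_mx_scalar -scalemxAl => ->.
  by rewrite -mul_scalar_mx -scalar_mxM.
have Bs : (l%:M - S)^T = l%:M - S by rewrite linearB /= tr_scalar_mx Ss.
have := psd_kernel Bs (g := v); rewrite mulmxBr mul_mx_scalar => H.
apply/esym/eqP; rewrite -subr_eq0; apply/eqP/H; last by rewrite qB vK mulr1 subrr.
move=> u; rewrite qB subr_ge0.
have [u0|u0] := eqVneq (qform 1%:M u) 0.
  have -> : u = 0.
    apply/rowP => i; rewrite mxE; apply/eqP; rewrite -sqrf_eq0.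
    move/eqP: u0; rewrite sq psumr_eq0 => [/allP ui|k _]; last exact: sqr_ge0.
    by apply: (ui i); rewrite mem_index_enum.
  by rewrite -(scale0r v) !qformZ expr0n /= !mul0r mulr0.
have up : 0 < qform 1%:M u.
  by rewrite lt0r u0 sq sumr_ge0// => i _; exact: sqr_ge0.
have := vmax ((Num.sqrt (qform 1%:M u))^-1 *: u).
rewrite inE /K /= !qformZ exprVn sqr_sqrtr ?(ltW up)// mulVf// => /(_ erefl).
by rewrite mulrC ler_pdivrMr.
Qed.

(* Householder: reflect in the hyperplane orthogonal to [v - delta_mx 0 0]. *)
Lemma reflection_to n (v : 'rV[R]_n.+1) : v *m v^T = 1%:M ->
  exists H : 'M[R]_n.+1, [/\ H^T = H, H *m H = 1%:M & delta_mx 0 0 *m H = v].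
Proof.
move=> v1; set e : 'rV[R]_n.+1 := delta_mx 0 0.
have [<-|ve] := eqVneq e v; first by exists 1%:M; rewrite trmx1 !mulmx1.
have [u uE] : exists u, u = v - e by exists (v - e).
pose a := v ord0 ord0.
have ee : e *m e^T = 1%:M.
  by apply/matrixP => i j; rewrite !ord1 trmx_delta mul_delta_mx !mxE.
have ev : e *m v^T = a%:M.
  by apply/matrixP => i j; rewrite !ord1 -rowE !mxE mulr1n.
have vE : v *m e^T = a%:M.
  by apply: trmx_inj; rewrite trmx_mul trmxK ev tr_scalar_mx.
have uu : u *m u^T = (2 * (1 - a))%:M.
  rewrite uE linearB /= mulmxBl !mulmxBr v1 vE ev ee -!raddfB /=.
  by congr (_%:M); ring.
have a1 : 1 - a != 0.
  apply: contra ve => /eqP a1; rewrite eq_sym -subr_eq0 -uE; apply/eqP/rowP => i.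
  move/matrixP/(_ ord0 ord0): uu; rewrite a1 mulr0 !mxE /= mul0rn => /eqP.
  rewrite psumr_eq0 => [/allP /(_ i (mem_index_enum _)) /=|j _]; last by rewrite mxE -expr2 sqr_ge0.
  by rewrite !mxE mulf_eq0 orbb => /eqP.
exists (1%:M - (1 - a)^-1 *: (u^T *m u)); split.
- by rewrite linearB /= linearZ /= trmx1 trmx_mul trmxK.
- rewrite mulmxBl !mulmxBr !mulmx1 mul1mx -scalemxAl -scalemxAr.
  have -> : u^T *m u *m (u^T *m u) = (2 * (1 - a)) *: (u^T *m u).
    by rewrite mulmxA -[u^T *m u *m _]mulmxA uu mul_mx_scalar scalemxAl.
  rewrite !scalerA (_ : (1 - a)^-1 * (1 - a)^-1 * _ = (1 - a)^-1 + (1 - a)^-1); last by field.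
  by rewrite scalerDl opprB addrK subrK.
- have eu : e *m u^T = (a - 1)%:M.
    by rewrite uE [(v - e)^T]linearB /= mulmxBr ev ee -raddfB.
  rewrite mulmxBr mulmx1 -scalemxAr mulmxA eu mul_scalar_mx scalerA.
  by rewrite -[a - 1]opprB mulrN mulVf// scaleN1r opprK uE addrC subrK.
Qed.

(** A reflection turns an eigenvector into the first basis vector; symmetry then clears the first
    row and column, and induction handles the remaining block. *)
Lemma spectral_theorem n (S : 'M[R]_n) : S^T = S ->
  exists (P : 'M[R]_n) (d : 'rV[R]_n),
    P *m P^T = 1%:M /\ P *m S *m P^T = diag_mx d.
Proof.
elim: n S => [|n IH] S Ss.
  by exists 1%:M, 0; split; apply/matrixP => -[].
have [v [l [vS v1]]] := sym_eigenvector Ss.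
have [H [Hs HH He]] := reflection_to v1.
have [T TH] : exists T : 'M[R]_(1 + n), T = H *m S *m H by exists (H *m S *m H).
have Ts : T^T = T by rewrite TH !trmx_mul Hs Ss mulmxA.
have Te : (delta_mx 0 0 : 'rV[R]_(1 + n)) *m T = l *: delta_mx 0 0.
  by rewrite TH !mulmxA He vS -scalemxAl -He -mulmxA HH mulmx1.
have Trow j : T ord0 j = l * (ord0 == j)%:R.
  by move/matrixP/(_ ord0 j): Te; rewrite -rowE !mxE eqxx /= eq_sym => ->.
have l0 : lshift n ord0 = ord0 :> 'I_(1 + n) by exact/val_inj.
have TE : T = block_mx l%:M 0 0 (drsubmx T).
  rewrite -[LHS]submxK; congr block_mx; apply/matrixP => i j.
  - by rewrite !ord1 !mxE l0 Trow mulr1.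
  - by rewrite !ord1 !mxE l0 Trow (_ : (_ == _) = false) ?mulr0.
  - by rewrite !ord1 !mxE -{1}Ts mxE l0 Trow (_ : (_ == _) = false) ?mulr0.
have T's : (drsubmx T)^T = drsubmx T by rewrite trmx_drsub Ts.
have [P [d [PP PT]]] := IH _ T's.
pose B : 'M[R]_(1 + n) := block_mx 1%:M 0 0 P.
have BtE : B^T = block_mx 1%:M 0 0 P^T by rewrite tr_block_mx trmx1 !trmx0.
have BB : B *m B^T = 1%:M.
  rewrite BtE mulmx_block !(mulmx1, mul1mx, mul0mx, mulmx0, addr0, add0r) PP.
  by rewrite -scalar_mx_block.
have BT : B *m T *m B^T = diag_mx (row_mx l%:M d).
  rewrite BtE TE !mulmx_block !(mulmx1, mul1mx, mul0mx, mulmx0, addr0, add0r) PT.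
  rewrite diag_mx_row; congr block_mx.
  by apply/matrixP => i j; rewrite !ord1 !mxE.
move: B BB BT {BtE} => B BB BT.
exists (B *m H), (row_mx l%:M d); split; rewrite trmx_mul Hs.
  by rewrite mulmxA -[_ *m H *m H]mulmxA HH mulmx1.
by rewrite -BT TH !mulmxA.
Qed.

End Spectral.

(** * Eigenvalues of a matrix pencil *)

Section Pencil.
Context {R : realType}.

Lemma char_poly_conj m (A V W : 'M[R]_m) :
  W *m V = 1%:M -> char_poly (V *m A *m W) = char_poly A.
Proof.
move=> WV; have VW := mulmx1C WV.
have h (B C : 'M[R]_m) : map_mx polyC (B *m C) = map_mx polyC B *m map_mx polyC C.
  exact: map_mxM.
have VWp : map_mx polyC V *m map_mx polyC W = 1%:M by rewrite -h VW map_mx1.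
rewrite /char_poly /char_poly_mx !h.
have -> : 'X%:M - map_mx polyC V *m map_mx polyC A *m map_mx polyC W =
    map_mx polyC V *m ('X%:M - map_mx polyC A) *m map_mx polyC W.
  by rewrite mulmxBr mulmxBl mul_mx_scalar -scalemxAl VWp scalemx1.
by rewrite !det_mulmx mulrAC -det_mulmx VWp det1 mul1r.
Qed.

(** This is [D^-1 A], in general not symmetric; it is studied through the two quadratic forms of [A]
    and [D]. *)
Definition pencil m (A : 'M[R]_m) (mu : 'I_m -> R) : 'M[R]_m :=
  \matrix_(i, j) (A i j / mu i).

(** If the orthogonal [P] diagonalises [D^(-1/2) A D^(-1/2)], then [V = P D^(-1/2)] diagonalises
    both forms at once, and its inverse is [D V^T]. *)
Lemma pencil_diag m (A : 'M[R]_m) (mu : 'I_m -> R) :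
    A^T = A -> (forall i, 0 < mu i) ->
  exists (V W : 'M[R]_m) (d : 'rV[R]_m),
    [/\ W *m V = 1%:M,
        forall c, qform A (c *m V) = \sum_i d ord0 i * c ord0 i ^+ 2,
        forall c, wnorm mu (c *m V) = \sum_i c ord0 i ^+ 2 &
        char_poly (pencil A mu) = \prod_i ('X - (d ord0 i)%:P)].
Proof.
move=> As mu0.
pose E : 'M[R]_m := diag_mx (\row_i (Num.sqrt (mu i))^-1).
pose D : 'M[R]_m := diag_mx (\row_i mu i).
have Et : E^T = E by rewrite tr_diag_mx.
have EDE : E *m D *m E = 1%:M.
  rewrite !mulmx_diag -diag_const_mx; congr diag_mx; apply/rowP => i; rewrite !mxE.
  rewrite mulrAC -expr2 exprVn sqr_sqrtr ?ltW// mulVf//; exact: lt0r_neq0.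
have [P [d [PP PS]]] : exists (P : 'M[R]_m) (d : 'rV[R]_m),
    P *m P^T = 1%:M /\ P *m (E *m A *m E) *m P^T = diag_mx d.
  by apply: spectral_theorem; rewrite !trmx_mul Et As mulmxA.
have [V VE] : exists V, V = P *m E by exists (P *m E).
have VDV : V *m D *m V^T = 1%:M.
  rewrite VE trmx_mul Et !mulmxA -[_ *m E *m D]mulmxA -[P *m (E *m D) *m E]mulmxA EDE.
  by rewrite mulmx1.
have VAV : V *m A *m V^T = diag_mx d.
  by rewrite -PS VE trmx_mul Et !mulmxA.
have VDV' : V *m (D *m V^T) = 1%:M by rewrite mulmxA.
have WV := mulmx1C VDV'.
exists V, (D *m V^T), d; split => //.
- move=> c; apply: scalar_mx1_inj; rewrite -qformE trmx_mul !mulmxA.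
  rewrite -[c *m V *m A]mulmxA -[c *m (V *m A) *m V^T]mulmxA VAV.
  apply/matrixP => a b; rewrite !ord1 !mxE /= mulr1n.
  by apply: eq_bigr => i _; rewrite mul_mx_diag !mxE; ring.
- move=> c; apply: scalar_mx1_inj; rewrite -wnormE trmx_mul !mulmxA -/D.
  rewrite -[c *m V *m D]mulmxA -[c *m (V *m D) *m V^T]mulmxA VDV mulmx1.
  apply/matrixP => a b; rewrite !ord1 !mxE /= mulr1n.
  by apply: eq_bigr => i _; rewrite !mxE expr2.
- have Dinv : D *m (V^T *m V) = 1%:M by rewrite mulmxA.
  have -> : pencil A mu = V^T *m diag_mx d *m (V *m D).
    have VtV : V^T *m (V *m D) = 1%:M by rewrite mulmxA; exact: mulmx1C.
    rewrite -VAV !mulmxA -[_ *m V^T *m V *m D]mulmxA -[_ *m V^T *m (V *m D)]mulmxA VtV mulmx1.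
    have DM : D *m pencil A mu = A.
      apply/matrixP => i j; rewrite mul_diag_mx !mxE mulrCA mulfV ?mulr1//.
      exact: lt0r_neq0.
    by rewrite -[A in RHS]DM !mulmxA -[_ *m V *m D]mulmxA VtV mul1mx.
  rewrite char_poly_conj//.
  rewrite char_poly_trig ?diag_mx_is_trig//.
  by apply: eq_bigr => i _; rewrite mxE eqxx mulr1n.
Qed.

(** Sorting the [d] entries shows that [xget] does not fall back on its default; unique
    factorisation identifies the list it chose. *)
Lemma eigsP m (M : 'M[R]_m) (d : 'rV[R]_m) :
    char_poly M = \prod_i ('X - (d ord0 i)%:P) ->
  sorted <=%R (eigs M) /\ perm_eq (eigs M) [seq d ord0 i | i <- index_enum 'I_m].
Proof.
move=> cM.
have := @xgetPex _ [::] [set s : seq R | sorted <=%R s /\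
                             char_poly M = \prod_(x <- s) ('X - x%:P)].
rewrite -/(eigs M) /= => -[|es eM].
  exists (sort <=%R [seq d ord0 i | i <- index_enum 'I_m]); split.
    exact: (sort_sorted le_total).
  rewrite cM -(big_map (fun i => d ord0 i) xpredT (fun x => 'X - x%:P)).
  by apply: perm_big; rewrite perm_sym perm_sort.
split=> //; apply: prod_XsubC_eq; rewrite -eM cM big_map.
by apply: eq_bigr.
Qed.

Lemma count_eigs m (M : 'M[R]_m) (d : 'rV[R]_m) c :
    char_poly M = \prod_i ('X - (d ord0 i)%:P) ->
  count (fun x => x < c) (eigs M) = #|[set i | d ord0 i < c]%SET|.
Proof.
move=> /eigsP[_ /permP ->]; rewrite count_map cardE /enum_mem size_filter.
rewrite -enumT -[index_enum _]enumT; apply: eq_count => i.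
by rewrite /= finset.in_set.
Qed.

Lemma count_lt_nth (s : seq R) k : sorted <=%R s -> (k < size s)%N ->
  (count (fun x => (x < nth 0 s k)%R) s <= k)%N.
Proof.
move=> ss ks; rewrite -{2}(cat_take_drop k s) count_cat.
rewrite (_ : count _ (drop k s) = 0%N) ?addn0.
  by rewrite (leq_trans (count_size _ _))// size_take ks.
apply/eqP; rewrite -leqn0 leqNgt -has_count; apply/hasPn => x /(nthP 0)[i].
rewrite size_drop nth_drop => ik <-; rewrite -leNgt.
apply: (sorted_leq_nth le_trans lexx) => //; rewrite ?inE ?leq_addr//.
by rewrite -ltn_subRL.
Qed.

Lemma nth_count_lt (s : seq R) k c : sorted <=%R s -> (k < size s)%N ->
  (count (fun x => (x < c)%R) s <= k)%N -> c <= nth 0 s k.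
Proof.
move=> ss ks; apply: contraTT; rewrite -ltNge -ltnNge => sc.
rewrite -[X in count _ X](cat_take_drop k.+1 s) count_cat (leq_trans _ (leq_addr _ _))//.
suff : all (fun x => (x < c)%R) (take k.+1 s).
  by rewrite all_count => /eqP ->; rewrite size_takel.
apply/allP => x /(nthP 0)[i].
rewrite size_takel// => ik <-; rewrite nth_take//; apply: le_lt_trans sc.
by apply: (sorted_leq_nth le_trans lexx) => //; rewrite inE ?(leq_trans ik).
Qed.

(** * The Courant-Fischer inequalities *)

Section CourantFischer.
Variables (m : nat) (A : 'M[R]_m) (mu : 'I_m -> R) (j : nat).
Hypotheses (As : A^T = A) (mu0 : forall i, 0 < mu i) (jm : (0 < j <= m)%N).

Let size_eigs (d : 'rV[R]_m) :
  char_poly (pencil A mu) = \prod_i ('X - (d ord0 i)%:P) ->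
  (j.-1 < size (eigs (pencil A mu)))%N.
Proof.
move=> /eigsP[_ /perm_size ->]; rewrite size_map.
by move: jm; rewrite -[index_enum _]enumT size_enum_ord; case: (j).
Qed.

(** The equations say that [g] has no component along the eigenvectors with eigenvalue below the
    [j]-th; there are at most [j - 1] of these. *)
Lemma eig_constraints : exists (r : nat) (L : 'M[R]_(m, r)), (r < j)%N /\
  forall g, g *m L = 0 -> eig (pencil A mu) j * wnorm mu g <= qform A g.
Proof.
have [V [W [d [WV QV NV cM]]]] := pencil_diag As mu0.
set l := eig _ j; pose I := [set i | d ord0 i < l]%SET.
exists #|I|, (\matrix_(i, a) W i (enum_val a)); split.
  have [ss _] := eigsP cM.
  rewrite -(count_eigs _ cM) -(ltn_predK (proj1 (andP jm))) ltnS.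
  by apply: count_lt_nth => //; exact: size_eigs cM.
move=> g gL; have gE : g = (g *m W) *m V by rewrite -mulmxA WV mulmx1.
rewrite gE NV QV mulr_sumr; apply: ler_sum => i _.
have [il|il] := boolP (i \in I); last first.
  by apply: ler_wpM2r; [exact: sqr_ge0|move: il; rewrite finset.in_set -leNgt].
have -> : (g *m W) ord0 i = 0.
  have /matrixP/(_ ord0 (enum_rank_in il i)) := gL; rewrite !mxE => {2}<-.
  by apply: eq_bigr => k _; rewrite mxE enum_rankK_in.
by rewrite expr0n !mulr0.
Qed.

(** If [j] eigenvalues were below [c], the span of their eigenvectors would contain a nonzero
    solution of the [r < j] equations, and there the form is less than [c * wnorm mu g]. *)
Lemma le_eig c (r : nat) (L : 'M[R]_(m, r)) : (r < j)%N ->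
    (forall g, g *m L = 0 -> c * wnorm mu g <= qform A g) ->
  c <= eig (pencil A mu) j.
Proof.
have [V [W [d [WV QV NV cM]]]] := pencil_diag As mu0 => rj cL.
have [ss _] := eigsP cM.
apply: nth_count_lt => //; first exact: size_eigs cM.
rewrite (count_eigs _ cM) -ltnS (ltn_predK (proj1 (andP jm))) ltnNge.
apply/negP; set I := [set i | _]%SET => jI.
pose s : 'M[R]_(#|I|, m) := \matrix_(a, i) (enum_val a == i)%:R.
have [u [u0 uL]] : exists u : 'rV[R]_#|I|, u != 0 /\ u *m (s *m V *m L) = 0.
  have : kermx (s *m V *m L) != 0.
    rewrite kermx_eq0 /row_free; apply/eqP => E.
    by have := rank_leq_col (s *m V *m L); rewrite E leqNgt (leq_trans rj).
  move=> /rowV0Pn[u /sub_kermxP uk u0]; by exists u.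
have := cL (u *m s *m V); rewrite -!mulmxA mulmxA !mulmxA in uL *.
move=> /(_ uL); apply/negP; rewrite -ltNge NV QV.
have uI a : (u *m s) ord0 (enum_val a) = u ord0 a.
  rewrite mxE (bigD1 a)//= mxE eqxx mulr1 big1 ?addr0// => b ba.
  by rewrite mxE (inj_eq enum_val_inj) (negPf ba) mulr0.
have uNI i : i \notin I -> (u *m s) ord0 i = 0.
  move=> iI; rewrite mxE big1// => a _; rewrite mxE; case: eqP; rewrite ?mulr0//.
  by move=> E; move: iI; rewrite -E enum_valP.
have [a ua] : exists a, u ord0 a != 0 by apply/rV0Pn.
rewrite mulr_sumr -subr_gt0 -sumrB (bigD1 (enum_val a))//=.
have dI i : i \in I -> 0 < c - d ord0 i by rewrite finset.in_set subr_gt0.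
apply: ltr_pwDl.
  rewrite -mulrBl mulr_gt0 ?dI ?enum_valP// lt0r sqr_ge0 andbT sqrf_eq0.
  by rewrite uI.
apply: sumr_ge0 => i _; rewrite -mulrBl; have [iI|iI] := boolP (i \in I).
  by rewrite mulr_ge0 ?sqr_ge0// ltW// dI.
by rewrite uNI// expr0n mulr0.
Qed.

Lemma qform_le_eig g : j = m -> qform A g <= eig (pencil A mu) j * wnorm mu g.
Proof.
move=> jE; have [V [W [d [WV QV NV cM]]]] := pencil_diag As mu0.
have [ss pm] := eigsP cM.
have gE : g = (g *m W) *m V by rewrite -mulmxA WV mulmx1.
rewrite gE NV QV mulr_sumr; apply: ler_sum => i _; apply: ler_wpM2r; first exact: sqr_ge0.
have /(nthP 0)[k ks <-] : d ord0 i \in eigs (pencil A mu).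
  by rewrite (perm_mem pm) map_f// mem_index_enum.
have js := size_eigs cM.
have sm : size (eigs (pencil A mu)) = m.
  by rewrite (perm_size pm) size_map -[index_enum _]enumT size_enum_ord.
apply: (sorted_leq_nth le_trans lexx) => //.
by rewrite jE -ltnS (leq_trans ks)// sm leqSpred.
Qed.

End CourantFischer.
End Pencil.

(** * Signed powers *)

Section SignedPowers.
Context {R : realType}.
Implicit Types a b p r s t u v : R.

Definition spow r t : R := Num.sg t * `|t| `^ r.

Lemma spowN r t : spow r (- t) = - spow r t.
Proof. by rewrite /spow sgrN normrN mulNr. Qed.

Lemma ge0_spow r t : 0 < r -> 0 <= t -> spow r t = t `^ r.
Proof.
move=> r0; rewrite le_eqVlt => /orP[/eqP <-|t0].
  by rewrite /spow sgr0 mul0r powR0// lt0r_neq0.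
by rewrite /spow gtr0_sg// mul1r ger0_norm// ltW.
Qed.

Lemma norm_spow r t : 0 < r -> `|spow r t| = `|t| `^ r.
Proof.
move=> r0; wlog t0 : t / 0 <= t.
  move=> H; have [/H//|/ltW t0] := leP 0 t.
  by have := H (- t); rewrite oppr_ge0 spowN !normrN => /(_ t0).
by rewrite ge0_spow// !ger0_norm// powR_ge0.
Qed.

Lemma spowK r s : 0 < r -> r * s = 1 -> cancel (spow r) (spow s).
Proof.
move=> r0 rs t; have s0 : 0 < s by rewrite -(pmulr_rgt0 _ r0) rs.
wlog t0 : t / 0 <= t.
  move=> H; have [/H//|/ltW t0] := leP 0 t.
  by have := H (- t); rewrite oppr_ge0 !spowN => /(_ t0)/oppr_inj.
by rewrite (ge0_spow r0)// ge0_spow// ?powR_ge0// -powRrM rs powRr1.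
Qed.

Lemma spow_ge0 r t : 0 < r -> (0 <= spow r t) = (0 <= t).
Proof.
move=> r0; have [t0|t0] := leP 0 t; first by rewrite ge0_spow// powR_ge0.
have tN : 0 < - t by rewrite oppr_gt0.
rewrite -[t]opprK spowN (ge0_spow r0 (ltW tN)) oppr_ge0 leNgt powR_gt0//.
Qed.

Lemma spow_lt r : 0 < r -> {homo spow r : a b / a < b}.
Proof.
move=> r0.
have H a b : 0 <= a -> a < b -> spow r a < spow r b.
  move=> a0 ab; have b0 := le_lt_trans a0 ab.
  by rewrite !ge0_spow// ?(ltW b0)// gt0_ltr_powR// nnegrE// ltW.
move=> a b ab; have [a0|a0] := leP 0 a; first exact: H.
have [b0|b0] := leP 0 b.
  by apply: (@lt_le_trans _ _ 0); rewrite ?spow_ge0// ltNge spow_ge0// -ltNge.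
by rewrite -ltrN2 -!spowN H ?oppr_ge0 ?ltW// ltrN2.
Qed.

(** The inverse power is increasing as well, so it pulls an interval around [spow r t] back to one
    around [t]; the point 0 needs no separate case. *)
Lemma continuous_spow r : 0 < r -> continuous (spow r).
Proof.
move=> r0 t; pose s := r^-1.
have s0 : 0 < s by rewrite invr_gt0.
have sK : cancel (spow s) (spow r) by apply: spowK => //; rewrite mulVf// lt0r_neq0.
have rK : cancel (spow r) (spow s) by apply: spowK => //; rewrite mulfV// lt0r_neq0.
apply/cvgrPdist_lt => e e0.
have l0 : spow s (spow r t - e) < t.
  by rewrite -[ltRHS]rK; apply: spow_lt => //; rewrite ltrBlDr ltrDl.
have g0 : t < spow s (spow r t + e).
  by rewrite -[ltLHS]rK; apply: spow_lt => //; rewrite ltrDl.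
have d0 : 0 < Num.min (t - spow s (spow r t - e)) (spow s (spow r t + e) - t).
  by rewrite lt_min !subr_gt0 l0.
near=> x.
have : `|t - x| < Num.min (t - spow s (spow r t - e)) (spow s (spow r t + e) - t).
  by near: x; apply: (iffLR (@cvgrPdist_lt _ _ _ _ _ id t)) => //; exact: cvg_id.
rewrite lt_min => /andP[]; rewrite ltr_norml => /andP[_ h1]; rewrite ltr_norml => /andP[h2 _].
have h3 : spow s (spow r t - e) < x by lra.
have h4 : x < spow s (spow r t + e) by lra.
move: (spow_lt r0 h3) (spow_lt r0 h4); rewrite !sK => h5 h6.
by rewrite ltr_norml; apply/andP; split; lra.
Unshelve. all: by end_near. Qed.

(** Young's inequality for [t * 1], rearranged; the exponent 1 has no finite conjugate and is
    treated apart. *)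
Lemma bernoulli_powR r t : 1 <= r -> 0 <= t -> 1 + r * (t - 1) <= t `^ r.
Proof.
rewrite le_eqVlt => /orP[/eqP <- t0|r1 t0]; first by rewrite mul1r subrKC powRr1.
have r0 : 0 < r := lt_trans ltr01 r1.
have rN0 : r != 0 by rewrite lt0r_neq0.
have r1N0 : r - 1 != 0 by rewrite subr_eq0 gt_eqF.
have q0 : 0 < r / (r - 1) by rewrite divr_gt0// subr_gt0.
have pq : r^-1 + (r / (r - 1))^-1 = 1 by field; rewrite rN0 r1N0.
have := conjugate_powR t0 ler01 r0 q0 pq.
rewrite powR1 invf_div mulr1 mul1r -mulrDl ler_pdivlMr//.
lra.
Qed.

(** Write [u = m * (1 + d)] and [v = m * (1 - d)], so that [u * v = m ^+ 2 * (1 - d ^+ 2)], and let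
    [r = p / 2]. Bernoulli bounds the gap by m^p r d^2, and applied to (1 + d)^r it gives m^p (r
    d)^2 <= u^p <= C; dividing by [r] bounds the gap by [C / r]. *)
Lemma mean_powR u v p C : 2 <= p -> 0 <= v <= u -> u `^ p <= C ->
  (u * v) `^ (p / 2) <= ((u + v) / 2) `^ p <= (u * v) `^ (p / 2) + 2 * C / p.
Proof.
move=> p2 /andP[v0 vu] uC; have u0 : 0 <= u := le_trans v0 vu.
have p0 : 0 < p by apply: lt_le_trans p2.
have C0 : 0 <= C by apply: le_trans uC; exact: powR_ge0.
move: u0; rewrite le_eqVlt => /orP[/eqP u0|u0].
  have -> : v = 0 by apply/eqP; rewrite eq_le v0 u0 vu.
  rewrite -u0 addr0 mul0r powR0 ?lt0r_neq0 ?divr_gt0// mul0r powR0 ?lt0r_neq0//.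
  by rewrite lexx add0r divr_ge0 ?mulr_ge0// ltW.
set m := (u + v) / 2; pose r := p / 2; pose d := (u - v) / (u + v).
have uv0 : 0 < u + v by rewrite ltr_pwDl.
have m0 : 0 < m by rewrite divr_gt0.
have r1 : 1 <= r by rewrite ler_pdivlMr// mul1r.
have d0 : 0 <= d by rewrite divr_ge0 ?subr_ge0// ltW.
have d1 : d <= 1 by rewrite ler_pdivrMr// mul1r lerBlDr -addrA lerDl addr_ge0.
have dd0 : 0 <= 1 - d ^+ 2 by rewrite subr_ge0 expr_le1.
have uvE : u * v = m ^+ 2 * (1 - d ^+ 2) by rewrite /m /d; field; rewrite lt0r_neq0.
have uE : u = m * (1 + d) by rewrite /m /d; field; rewrite lt0r_neq0.
have pE x : 0 <= x -> x `^ p = (x ^+ 2) `^ r.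
  by move=> x0; rewrite -powR_mulrn// -powRrM /r mulrCA mulfV ?mulr1.
rewrite -/r uvE (powRM _ (sqr_ge0 _) dd0) -(pE _ (ltW m0)).
have mp : 0 <= m `^ p := powR_ge0 _ _.
have b1 := bernoulli_powR r1 dd0.
have b2 : (1 - d ^+ 2) `^ r <= 1.
  by rewrite -[leRHS](congr1 (fun f => f r) (powR1 R)) ge0_ler_powR ?nnegrE// ?(le_trans ler01)// lerBlDr lerDl sqr_ge0.
have b3 : m `^ p * (r * d) ^+ 2 <= C.
  have d10 : 0 <= 1 + d by rewrite addr_ge0.
  apply: le_trans uC; rewrite uE (powRM _ (ltW m0) d10) ler_pM2l ?powR_gt0//.
  have rd0 : 0 <= r * d by rewrite mulr_ge0// (le_trans ler01).
  rewrite (pE _ d10) [(1 + d) ^+ 2]expr2 (powRM _ d10 d10) -expr2.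
  rewrite ler_sqr ?nnegrE ?powR_ge0//.
  have := bernoulli_powR r1 d10; lra.
apply/andP; split; first by rewrite ler_piMr.
have -> : 2 * C / p = C / r by rewrite /r; field; rewrite lt0r_neq0.
have r0 : 0 < r := lt_le_trans ltr01 r1.
rewrite -lerBlDl -{1}[m `^ p]mulr1 -mulrBr ler_pdivlMr//.
apply: le_trans b3; rewrite -mulrA; apply: ler_wpM2l => //.
have -> : (r * d) ^+ 2 = (r * d ^+ 2) * r by ring.
by apply: ler_wpM2r; [exact: ltW|lra].
Qed.

(** For opposite signs half the distance is the mean of the moduli and [mean_powR] applies. For
    equal signs the distance is at most the larger modulus, and 2^p >= 1 + p makes the power small.
    The constant 3 covers both cases. *)
Lemma edge_estimate a b p C : 2 <= p -> `|a| `^ p <= C -> `|b| `^ p <= C ->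
  `| (`|a - b| / 2) `^ p - Num.max 0 (- (spow (p / 2) a * spow (p / 2) b)) |
  <= 3 * C / p.
Proof.
move=> p2; have p0 : 0 < p by apply: lt_le_trans p2.
have r0 : 0 < p / 2 by rewrite divr_gt0.
wlog ba : a b / `|b| <= `|a|.
  move=> H aC bC; have [ba|/ltW ab] := leP `|b| `|a|; first exact: H.
  by have := H b a ab bC aC; rewrite [`|b - a|]distrC [spow _ b * _]mulrC.
move=> aC _; have C0 : 0 <= C by apply: le_trans aC; exact: powR_ge0.
wlog a0 : a b ba aC / 0 <= a.
  move=> H; have [/(H _ b ba aC)//|/ltW a0] := leP 0 a.
  have := H (- a) (- b); rewrite !normrN oppr_ge0 !spowN mulrNN => /(_ ba aC a0).
  by rewrite -opprD normrN.
have nb := powR_ge0; rewrite (ger0_norm a0) in ba aC.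
have [b0|b0] := leP 0 b.
  have ab0 : 0 <= spow (p / 2) a * spow (p / 2) b by rewrite mulr_ge0// spow_ge0.
  rewrite (max_idPl _) ?oppr_le0// subr0 ger0_norm ?powR_ge0//.
  rewrite (ger0_norm b0) in ba; rewrite ger0_norm ?subr_ge0//.
  have ab : 0 <= (a - b) / 2 by rewrite divr_ge0// subr_ge0.
  have h1 : ((a - b) / 2) `^ p <= (a / 2) `^ p.
    apply: (ge0_ler_powR (ltW p0)); rewrite ?nnegrE ?ab ?(divr_ge0 a0)//.
    by rewrite ler_pM2r ?invr_gt0// lerBlDr lerDl.
  apply: (le_trans h1).
  have := bernoulli_powR (le_trans (_ : 1 <= 2) p2) (_ : 0 <= 2) => /(_ _ _).
  rewrite (_ : (2:R) - 1 = 1)//; last by ring.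
  rewrite mulr1 => /(_ (ler1n _ 2) (ler0n _ 2)) h2.
  have e2 : (a / 2) `^ p * 2 `^ p = a `^ p.
    by rewrite -powRM ?divr_ge0// divfK// pnatr_eq0.
  have h3 := powR_ge0 (a / 2) p.
  rewrite ler_pdivlMr//; nra.
rewrite (ltr0_norm b0) in ba.
have -> : `|a - b| = a + - b by rewrite ger0_norm// subr_ge0 (le_trans (ltW b0)).
have -> : - (spow (p / 2) a * spow (p / 2) b) = (a * - b) `^ (p / 2).
  rewrite -mulrN -spowN !ge0_spow// ?oppr_ge0 ?(ltW b0)// powRM// oppr_ge0 ltW//.
rewrite (max_idPr _) ?powR_ge0//.
have vu : 0 <= - b <= a by rewrite oppr_ge0 (ltW b0).
have /andP[h1 h2] := mean_powR p2 vu aC.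
rewrite ger0_norm ?subr_ge0// lerBlDl (le_trans h2)// lerD2l.
by rewrite ler_pM2r ?invr_gt0// ler_wpM2r// ler_nat.
Qed.

End SignedPowers.

(** * Spheres and genus *)

Lemma within_comp {T U W : topologicalType} (A : set T) (B : set U)
    (f : T -> U) (g : U -> W) :
    (forall x, A x -> B (f x)) -> (forall x, A x -> {for x, continuous f}) ->
    {within B, continuous g} -> {within A, continuous (g \o f)}.
Proof.
move=> AB cf /subspace_continuousP cg; apply/subspace_continuousP => x Ax.
apply: cvg_trans (cg _ (AB x Ax)) => P; rewrite /= !nbhs_simpl /within /= => HP.
have := cf x Ax _ HP; rewrite /= !nbhs_simpl /=.
by apply: filterS => y yP Ay; apply: yP; exact: AB.
Qed.

Lemma continuous_coord {T : topologicalType} {R : realType} {n : nat}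
    (f : T -> 'rV[R]_n) x :
  (forall j, {for x, continuous (fun y => f y ord0 j)}) -> {for x, continuous f}.
Proof.
move=> cf A [P Px PA]; rewrite /= nbhs_simpl /=.
have H : \forall y \near x, forall j, P ord0 j (f y ord0 j).
  by apply: filter_forall => j; exact: (cf j _ (Px ord0 j)).
apply: filterS H => y yP; apply: PA => i j; rewrite ord1; exact: yP.
Qed.

Section Transfer.
Context {R : realType} {n : nat}.
Variable mu : 'I_n -> R.
Hypothesis mu0 : forall i, 0 < mu i.
Implicit Types (p q : R) (f g : 'rV[R]_n) (B : set 'rV[R]_n).

Definition psi (r : R) f : 'rV[R]_n := \row_i spow r (f ord0 i).

Lemma psiN r f : psi r (- f) = - psi r f.
Proof. by apply/rowP => i; rewrite !mxE spowN. Qed.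

Lemma psiK r s : 0 < r -> r * s = 1 -> cancel (psi r) (psi s).
Proof. by move=> r0 rs f; apply/rowP => i; rewrite !mxE spowK. Qed.

Lemma continuous_psi r : 0 < r -> continuous (psi r).
Proof.
move=> r0 f; apply: continuous_coord => j.
have -> : (fun g => psi r g ord0 j) = spow r \o (fun g => g ord0 j).
  by apply/funext => g; rewrite mxE.
apply: (@continuous_comp _ _ _ (fun y : 'rV[R]_n => y ord0 j) (spow r)).
  exact: coord_continuous.
exact: continuous_spow.
Qed.

Lemma pden_psi p q f : 0 < p -> 0 < q -> pden mu q (psi (p / q) f) = pden mu p f.
Proof.
move=> p0 q0; apply: eq_bigr => i _.
by rewrite mxE norm_spow ?divr_gt0// -powRrM divfK// lt0r_neq0.
Qed.

(** The new set is the image of [B] under [psi (p / q)], written as a preimage so that closedness is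
    immediate; an odd map on it composes to one on [B]. *)
Lemma Fk_psi p q k B : 0 < p -> 0 < q ->
  Fk mu p k B -> Fk mu q k [set g | B (psi (q / p) g)].
Proof.
move=> p0 q0 [BS Bc BN Bk]; split.
- by move=> g /BS; rewrite /psphere /= pden_psi.
- by apply: (iffLR (continuous_closedP _)) Bc; apply: continuous_psi; rewrite divr_gt0.
- by move=> g /BN; rewrite /= psiN.
- move=> j jk [h [hc hN h0]]; apply: (Bk j jk).
  have K : cancel (psi (p / q)) (psi (q / p)).
    apply: psiK; first by rewrite divr_gt0.
    by field; rewrite !lt0r_neq0.
  exists (h \o psi (p / q)); split.
  + apply: within_comp hc => [x Bx|x Bx]; first by rewrite /= K.
    by apply: continuous_psi; rewrite divr_gt0.
  + by move=> x Bx /=; rewrite psiN hN//= K.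
  + by move=> x Bx /=; apply: h0; rewrite /= K.
Qed.

(** The empty set has, vacuously, an odd map into dimension 0. *)
Lemma Fk_nonempty p k B : (0 < k)%N -> Fk mu p k B -> B !=set0.
Proof.
move=> k0 [_ _ _ Bk]; apply/set0P/eqP => B0; apply: (Bk 0 k0).
exists (fun=> 0); rewrite B0; split => //.
by move=> x; apply: cvg_cst.
Qed.

Lemma pden2 g : pden mu 2 g = wnorm mu g.
Proof.
by apply: eq_bigr => i _; rewrite powR_mulrn// -normrX ger0_norm// sqr_ge0.
Qed.

Lemma continuous_wnorm : continuous (wnorm mu).
Proof.
have c k : continuous (fun g : 'rV[R]_n => g ord0 k) by exact: coord_continuous.
apply: continuous_sum => i _ x.
under eq_fun do rewrite expr2.
exact: (cvgM (cvg_cst _) (cvgM (c i x) (c i x))).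
Qed.

Lemma Fk_sphere k : (k <= n)%N -> Fk mu 2 k (psphere mu 2).
Proof.
move=> kn; split => //.
- have -> : psphere mu 2 = wnorm mu @^-1` [set 1].
    by apply/seteqP; split => g; rewrite /psphere /= pden2.
  by apply: (iffLR (continuous_closedP _)); [exact: continuous_wnorm|exact: closed_eq].
- move=> g; rewrite /psphere /= => g1; rewrite -[RHS]g1.
  by apply: eq_bigr => i _; rewrite mxE normrN.
move=> j jk [h [hc hN h0]].
(* Radial projection sends the shell into the weighted sphere, so [h \o rho] is subject to
   Borsuk-Ulam. *)
pose rho g : 'rV[R]_n := (Num.sqrt (wnorm mu g))^-1 *: g.
have wpos g : shell g -> 0 < wnorm mu g.
  move=> [_ g1]; rewrite lt_neqAle wnorm_ge0 => [|i]; last exact: ltW.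
  rewrite andbT eq_sym; apply: contraTN g1.
  rewrite psumr_eq0 => [/allP g0|i _]; last by rewrite mulr_ge0 ?sqr_ge0// ltW.
  rewrite -ltNge big1 ?ltr01// => i _; have := g0 i (mem_index_enum _).
  by rewrite /= mulf_eq0 gt_eqF//= sqrf_eq0 => /eqP ->; rewrite normr0.
have rhoS g : shell g -> psphere mu 2 (rho g).
  move=> /wpos gp; rewrite /psphere /= pden2 /wnorm.
  under eq_bigr do rewrite mxE exprMn mulrCA.
  by rewrite -mulr_sumr exprVn sqr_sqrtr ?(ltW gp)// mulVf// lt0r_neq0.
have rhoN g : rho (- g) = - rho g.
  by rewrite /rho scalerN; congr (- (_^-1 *: _)); congr Num.sqrt;
    apply: eq_bigr => i _; rewrite mxE sqrrN.
have : (n <= j)%N.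
  apply: (@borsuk_ulam R n j (h \o rho)).
  - apply: (within_comp rhoS _ hc) => g sg.
    have c1 : {for g, continuous (Num.sqrt \o wnorm mu)}.
      by apply: continuous_comp; [exact: continuous_wnorm|exact: sqrt_continuous].
    have s0 : Num.sqrt (wnorm mu g) != 0 by rewrite gt_eqF// sqrtr_gt0 wpos.
    exact: (cvgZ (cvgV s0 c1) cvg_id).
  - by move=> g /rhoS gS /=; rewrite rhoN hN.
  - by move=> g /rhoS gS /=; exact: h0.
by rewrite leqNgt (leq_trans jk kn).
Qed.

End Transfer.

(** * The limit of the Rayleigh quotients *)

Section CutLimit.
Context {R : realType} {n : nat}.
Variables (adj : rel 'I_n) (sigma w : 'I_n -> 'I_n -> R) (mu kappa : 'I_n -> R).
Hypothesis Gsg : signed_graph adj sigma w mu.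
Implicit Types (p : R) (f g : 'rV[R]_n) (B : set 'rV[R]_n).

Let mu0 i : 0 < mu i. Proof. by case: Gsg. Qed.

Let w0 i j : adj i j -> 0 < w i j.
Proof. by case: Gsg => _ _ _ H _ /H[]. Qed.

Let sigma1 i j : adj i j -> sigma i j = 1 \/ sigma i j = -1.
Proof. by case: Gsg => _ _ H _ _ /H[]. Qed.

(* The pointwise limit of [2 ^ -p] times the p-Rayleigh quotient, after the
   substitution [g = psi (p / 2) f] which identifies all the spheres S_p. *)
Definition cutQ g : R :=
  \sum_(i < n) \sum_(j < n | (i < j)%N && adj i j)
    w i j * Num.max 0 (- (sigma i j * g ord0 i * g ord0 j)).

Definition cutL (k : nat) : R :=
  inf [set x | exists2 B, Fk mu 2 k B & x = sup [set cutQ g | g in B]].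

(** Bounds the p-th power of each coordinate on S_p, with the same value for all [p]; this makes the
    errors uniform. *)
Let C : R := \sum_i (mu i)^-1.

Let C0 : 0 <= C.
Proof. by apply: sumr_ge0 => i _; rewrite invr_ge0 ltW. Qed.

Let coord_le p f i : psphere mu p f -> `|f ord0 i| `^ p <= C.
Proof.
move=> fp; apply: (@le_trans _ _ (mu i)^-1).
  rewrite -[leRHS]mul1r ler_pdivlMr// mulrC -[leRHS]fp /pden (bigD1 i)//= lerDl.
  by apply: sumr_ge0 => j _; rewrite mulr_ge0 ?powR_ge0// ltW.
by rewrite /C (bigD1 i)//= lerDl sumr_ge0// => j _; rewrite invr_ge0 ltW.
Qed.

(** The first part collects the edge errors of [edge_estimate]; the second bounds the potential
    term, as 2^-p <= 1 / p. *)
Let Kerr : R :=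
  (\sum_(i < n) \sum_(j < n | (i < j)%N && adj i j) w i j) * (3 * C) + (\sum_i `|kappa i|) * C.

Lemma Rayleigh_cutQ p f : 2 <= p -> psphere mu p f ->
  `|2 `^ (- p) * Rayleigh adj sigma w mu kappa p f - cutQ (psi (p / 2) f)|
  <= Kerr / p.
Proof.
move=> p2 fp; have p0 : 0 < p by apply: lt_le_trans p2.
have r0 : 0 < p / 2 by rewrite divr_gt0.
rewrite /Rayleigh fp divr1 /pnum mulrDr addrAC.
have twop : 2 `^ (- p) <= p^-1.
  rewrite powRN lef_pV2 ?posrE ?powR_gt0//.
  have := bernoulli_powR (le_trans (ler1n R 2) p2) (ler0n R 2).
  rewrite (_ : (2:R) - 1 = 1); last by ring.
  lra.
have hp x : 0 <= x -> 2 `^ (- p) * x `^ p = (x / 2) `^ p.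
  move=> x0; rewrite powRM// ?invr_ge0// mulrC; congr (_ * _).
  by rewrite -(@powR_inv1 _ 2)// -powRrM mulN1r.
apply: (le_trans (ler_normD _ _)); rewrite /Kerr mulrDl; apply: lerD.
  rewrite mulr_sumr -sumrB (le_trans (ler_norm_sum _ _ _))//.
  rewrite -mulrA mulr_suml; apply: ler_sum => i _.
  rewrite mulr_sumr -sumrB (le_trans (ler_norm_sum _ _ _))//.
  rewrite mulr_suml; apply: ler_sum => j /andP[_ ij].
  rewrite mulrCA hp// -mulrBr normrM (ger0_norm (ltW (w0 ij))).
  apply: ler_wpM2l; first exact: (ltW (w0 ij)).
  have sf : spow (p / 2) (sigma i j * f ord0 j) = sigma i j * spow (p / 2) (f ord0 j).
    by case: (sigma1 ij) => ->; rewrite ?mul1r// !mulN1r spowN.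
  have nf : `|sigma i j * f ord0 j| = `|f ord0 j|.
    by case: (sigma1 ij) => ->; rewrite ?mul1r// mulN1r normrN.
  have := @edge_estimate R (f ord0 i) (sigma i j * f ord0 j) p C p2 (coord_le i fp).
  rewrite nf => /(_ (coord_le j fp)); rewrite sf !mxE.
  by rewrite mulrCA mulrA.
rewrite normrM ger0_norm ?powR_ge0// mulrC.
apply: ler_pM => //.
rewrite (le_trans (ler_norm_sum _ _ _))// mulr_suml; apply: ler_sum => i _.
rewrite normrM; apply: ler_wpM2l => //.
by rewrite ger0_norm ?powR_ge0//; exact: coord_le.
Qed.

Lemma cutQ_ge0 g : 0 <= cutQ g.
Proof.
apply: sumr_ge0 => i _; apply: sumr_ge0 => j /andP[_ ij].
by rewrite mulr_ge0 ?(ltW (w0 ij))// le_max lexx.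
Qed.

Let M : R := \sum_(i < n) \sum_(j < n | (i < j)%N && adj i j) w i j * C.

Let cutQ_le g : psphere mu 2 g -> cutQ g <= M.
Proof.
move=> gS; apply: ler_sum => i _; apply: ler_sum => j /andP[_ ij].
apply: ler_wpM2l; first exact: ltW (w0 ij).
rewrite ge_max C0 /=.
have gi := coord_le i gS; have gj := coord_le j gS.
rewrite !powR_mulrn// !real_normK ?num_real// in gi gj.
have h1 := sqr_ge0 (g ord0 i + g ord0 j); have h2 := sqr_ge0 (g ord0 i - g ord0 j).
by case: (sigma1 ij) => ->; nra.
Qed.

Let cutQ_ub B : B `<=` psphere mu 2 -> has_ubound [set cutQ g | g in B].
Proof. by move=> BS; exists M => _ [g /BS gS <-]; exact: cutQ_le. Qed.

Lemma cutL_le k B : (0 < k)%N -> Fk mu 2 k B -> cutL k <= sup [set cutQ g | g in B].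
Proof.
move=> k0 FB; apply: ge_inf; last by exists B.
exists 0 => _ [B' FB' ->]; have [g Bg] := Fk_nonempty k0 FB'.
apply: (le_trans (cutQ_ge0 g)); apply: ub_le_sup; last by exists g.
by apply: cutQ_ub; case: FB'.
Qed.

(** The whole sphere, of genus at least [k] by Borsuk-Ulam, makes the set under the infimum
    nonempty. *)
Lemma le_cutL k c : (0 < k <= n)%N ->
  (forall B, Fk mu 2 k B -> exists2 g, B g & c <= cutQ g) -> c <= cutL k.
Proof.
move=> /andP[k0 kn] H; apply: lb_le_inf.
  by exists (sup [set cutQ g | g in psphere mu 2]); exists (psphere mu 2) => //; exact: Fk_sphere.
move=> _ [B FB ->]; have [g Bg cg] := H B FB.
apply: (le_trans cg); apply: ub_le_sup; last by exists g.
by apply: cutQ_ub; case: FB.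
Qed.

(** The maps [psi] exchange the competitors of the two min-max problems and change the functional by
    at most [Kerr / p], a bound that passes to the suprema and then to the infima. *)
Lemma lambdap_cutL p k : (0 < k <= n)%N -> 2 <= p ->
  `|cutL k - 2 `^ (- p) * lambdap adj sigma w mu kappa k p| <= Kerr / p.
Proof.
move=> /andP[k0 kn] p2; have p0 : 0 < p by apply: lt_le_trans p2.
have a0 : 0 < (2 : R) `^ (- p) by rewrite powR_gt0.
set a := 2 `^ (- p) in a0 *; pose e := Kerr / p.
pose val B := sup [set Rayleigh adj sigma w mu kappa p f | f in B].
have psiK2 : cancel (psi (n := n) (2 / p)) (psi (p / 2)).
  by apply: psiK; [rewrite divr_gt0|field; rewrite !lt0r_neq0].
have Rub B : B `<=` psphere mu p ->
    has_ubound [set Rayleigh adj sigma w mu kappa p f | f in B].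
  move=> BS; exists ((M + e) / a) => _ [f /BS fS <-].
  have := Rayleigh_cutQ p2 fS; rewrite -/a -/e ler_norml => /andP[_ h].
  have hM : cutQ (psi (p / 2) f) <= M by apply: cutQ_le; rewrite /psphere /= pden_psi.
  rewrite ler_pdivlMr// mulrC; lra.
have low B : Fk mu p k B -> (cutL k - e) / a <= val B.
  move=> FB; have FB' := Fk_psi p0 (ltr0n R 2 : 0 < 2) FB.
  have [BS _ _ _] := FB.
  have : cutL k <= a * val B + e; last by move=> h; rewrite ler_pdivrMr// mulrC; lra.
  apply: (le_trans (cutL_le k0 FB')); apply: ge_sup.
    by have [g Bg] := Fk_nonempty k0 FB'; exists (cutQ g); exists g.
  move=> _ [g /= Bg <-].
  have := Rayleigh_cutQ p2 (BS _ Bg); rewrite psiK2 -/a -/e ler_norml => /andP[h _].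
  have h2 : Rayleigh adj sigma w mu kappa p (psi (2 / p) g) <= val B.
    by apply: ub_le_sup; [exact: Rub|exists (psi (2 / p) g)].
  have := ler_wpM2l (ltW a0) h2; lra.
have up B : Fk mu 2 k B -> a * lambdap adj sigma w mu kappa k p - e <= sup [set cutQ g | g in B].
  move=> FB; have FB' := Fk_psi (ltr0n R 2 : 0 < 2) p0 FB.
  have [BS _ _ _] := FB; have [BS' _ _ _] := FB'.
  have h1 : lambdap adj sigma w mu kappa k p <= val [set g | B (psi (p / 2) g)].
    apply: ge_inf; last by exists [set g | B (psi (p / 2) g)].
    by exists ((cutL k - e) / a) => _ [B' FB'' ->]; exact: low.
  have h2 : val [set g | B (psi (p / 2) g)] <= (sup [set cutQ g | g in B] + e) / a.
    apply: ge_sup.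
      have [g Bg] := Fk_nonempty k0 FB'.
      by exists (Rayleigh adj sigma w mu kappa p g); exists g.
    move=> _ [f /= Bf <-]; rewrite ler_pdivlMr// mulrC.
    have := Rayleigh_cutQ p2 (BS' _ Bf); rewrite -/a -/e ler_norml => /andP[_ h].
    have h3 : cutQ (psi (p / 2) f) <= sup [set cutQ g | g in B].
      by apply: ub_le_sup; [exact: cutQ_ub|exists (psi (p / 2) f)].
    lra.
  have := le_trans h1 h2; rewrite ler_pdivlMr// mulrC; lra.
have h1 : (cutL k - e) / a <= lambdap adj sigma w mu kappa k p.
  apply: lb_le_inf; last by move=> _ [B FB ->]; exact: low.
  have FB := Fk_psi (ltr0n R 2 : 0 < 2) p0 (Fk_sphere mu0 kn).
  by eexists; eexists; first exact: FB.
have h2 : a * lambdap adj sigma w mu kappa k p - e <= cutL k.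
  apply: lb_le_inf; last by move=> _ [B FB ->]; exact: up.
  by eexists; eexists; first exact: (Fk_sphere mu0 kn).
move: h1; rewrite ler_pdivrMr// mulrC => h1.
by rewrite ler_norml; apply/andP; split; rewrite -/e; lra.
Qed.

Theorem Lcut_cutL k : (0 < k <= n)%N -> Lcut adj sigma w mu kappa k = cutL k.
Proof.
move=> kn; apply: cvg_lim => //; apply/cvgrPdist_lt => e e0.
near=> p.
have p2 : 2 <= p by near: p; apply: nbhs_pinfty_ge; rewrite num_real.
have p0 : 0 < p by apply: lt_le_trans p2.
apply: (le_lt_trans (lambdap_cutL kn p2)); rewrite ltr_pdivrMr// -ltr_pdivrMl//.
by near: p; apply: nbhs_pinfty_gt; rewrite num_real.
Unshelve. all: by end_near. Qed.

End CutLimit.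

(** * Quadratic forms of subgraphs *)

Lemma sum_sym_off_diag {R : realType} n (F : 'I_n -> 'I_n -> R) :
    (forall i j, F i j = F j i) -> (forall i, F i i = 0) ->
  \sum_i \sum_j F i j = 2 * \sum_(i < n) \sum_(j < n | (i < j)%N) F i j.
Proof.
move=> Fs F0; pose T (i j : 'I_n) : R := if (i < j)%N then F i j else 0.
have -> : \sum_(i < n) \sum_(j < n | (i < j)%N) F i j = \sum_i \sum_j T i j.
  by apply: eq_bigr => i _; rewrite big_mkcond.
rewrite mulr_natl mulr2n [X in X + _]exchange_big -big_split /=.
apply: eq_bigr => i _; rewrite -big_split /=; apply: eq_bigr => j _.
rewrite /T; case: ltngtP => [_|_|/val_inj ->]; rewrite ?addr0 ?add0r ?F0//.
Qed.

Section Subgraphs.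
Context {R : realType} {n : nat}.
Variables (adj : rel 'I_n) (sigma w : 'I_n -> 'I_n -> R) (mu : 'I_n -> R).
Hypothesis Gsg : signed_graph adj sigma w mu.
Implicit Types (V : {set 'I_n}) (E : rel 'I_n) (g : 'rV[R]_n).

Definition edge_entry E i j : R := if E i j then - sigma i j * w i j else 0.

Definition edge_form E g : R :=
  \sum_i \sum_j g ord0 i * edge_entry E i j * g ord0 j.

Definition sub_adj V E : 'M[R]_#|V| :=
  \matrix_(a, b) edge_entry E (enum_val a) (enum_val b).

Definition restr V : 'M[R]_(n, #|V|) := \matrix_(i, a) (i == enum_val a)%:R.

Lemma restrE V g a : (g *m restr V) ord0 a = g ord0 (enum_val a).
Proof.
rewrite mxE (bigD1 (enum_val a))//= mxE eqxx mulr1 big1 ?addr0// => i ia.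
by rewrite mxE (negPf ia) mulr0.
Qed.

Lemma restr_trK V : (restr V)^T *m restr V = 1%:M.
Proof.
apply/matrixP => a b; rewrite !mxE (bigD1 (enum_val b))//= !mxE eqxx mulr1.
rewrite (inj_eq enum_val_inj) eq_sym big1 ?addr0// => i ib.
by rewrite !mxE (negPf ib) mulr0.
Qed.

Lemma norm_adj_negE V E :
  norm_adj_neg V E sigma w mu = pencil (sub_adj V E) (fun a => mu (enum_val a)).
Proof. by apply/matrixP => a b; rewrite !mxE. Qed.

Lemma edge_entry_sym V E i j : is_subgraph adj V E ->
  edge_entry E i j = edge_entry E j i.
Proof.
move=> [Es Ea]; rewrite /edge_entry -Es; case: ifP => // /Ea[ij _ _].
by case: Gsg => _ _ /(_ j i ij)[-> _] /(_ j i ij)[-> _] _.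
Qed.

Lemma sub_adj_sym V E : is_subgraph adj V E -> (sub_adj V E)^T = sub_adj V E.
Proof. by move=> sub; apply/matrixP => a b; rewrite !mxE (edge_entry_sym _ _ sub). Qed.

Lemma qform_sub_adj V E g : is_subgraph adj V E ->
  qform (sub_adj V E) (g *m restr V) = edge_form E g.
Proof.
move=> [_ Ea]; pose F i j : R := g ord0 i * edge_entry E i j * g ord0 j.
have F0 i j : ~~ ((i \in V) && (j \in V)) -> F i j = 0.
  move=> ij; rewrite /F /edge_entry; case: ifP => [/Ea[_ iV jV]|]; last by rewrite mulr0 mul0r.
  by rewrite iV jV in ij.
transitivity (\sum_(i in V) \sum_(j in V) F i j).
  rewrite [RHS]big_enum_val; apply: eq_bigr => a _; rewrite [RHS]big_enum_val.
  by apply: eq_bigr => b _; rewrite !restrE mxE.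
rewrite big_mkcond; apply: eq_bigr => i _; rewrite big_mkcond /=.
case: ifP => iV; last by rewrite big1// => j _; rewrite -/(F i j) F0// iV.
by apply: eq_bigr => j _; case: ifP => // jV; rewrite -/(F i j) F0// iV jV.
Qed.

Lemma wnorm_restr V g : (forall i, i \notin V -> g ord0 i = 0) ->
  wnorm (fun a => mu (enum_val a)) (g *m restr V) = wnorm mu g.
Proof.
move=> g0; rewrite [RHS](bigID (mem V)) /= [X in _ + X]big1 ?addr0.
  rewrite big_enum_val; apply: eq_bigr => a _; by rewrite restrE.
by move=> i iV; rewrite g0// expr0n mulr0.
Qed.

Lemma edge_formE V E g : is_subgraph adj V E ->
  edge_form E g = 2 * \sum_(i < n) \sum_(j < n | (i < j)%N && adj i j)
    if E i j then w i j * - (sigma i j * g ord0 i * g ord0 j) else 0.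
Proof.
move=> sub; have [Es Ea] := sub; rewrite /edge_form sum_sym_off_diag.
- congr (_ * _); apply: eq_bigr => i _.
  rewrite big_mkcond [RHS]big_mkcond; apply: eq_bigr => j _ /=.
  case: ltnP => //= _; rewrite /edge_entry; case: ifP => [/Ea[-> _ _]|_]; first by ring.
  by rewrite mulr0 mul0r if_same.
- by move=> i j; rewrite (edge_entry_sym _ _ sub); ring.
- move=> i; rewrite /edge_entry; case: ifP => [/Ea[ii _ _]|_]; last by rewrite mulr0 mul0r.
  by case: Gsg => _ /(_ i); rewrite ii.
Qed.

Lemma edge_form_le_cutQ V E g : is_subgraph adj V E ->
  edge_form E g <= 2 * cutQ adj sigma w g.
Proof.
move=> sub; rewrite (edge_formE g sub) ler_pM2l//.
apply: ler_sum => i _; apply: ler_sum => j /andP[_ ij].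
have wij : 0 <= w i j by case: Gsg => _ _ _ /(_ i j ij)[_ /ltW].
case: ifP => _; first by apply: ler_wpM2l => //; rewrite le_max lexx orbT.
by rewrite mulr_ge0// le_max lexx.
Qed.

Let mu0 i : 0 < mu i. Proof. by case: Gsg. Qed.

(** To the fewer than [#|V| + k - n] equations of Courant-Fischer are added the [n - #|V|] equations
    that make [g] vanish outside [V]: fewer than [k] in all. *)
Lemma subgraph_constraints V E k :
    is_subgraph adj V E -> (0 < k <= n)%N -> (n - k + 1 <= #|V|)%N ->
  exists (r : nat) (L : 'M[R]_(n, r)), (r < k)%N /\
    forall g, g *m L = 0 ->
      eig (norm_adj_neg V E sigma w mu) (#|V| + k - n) * wnorm mu g
      <= edge_form E g.
Proof.
move=> sub /andP[k0 kn] kV.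
have Vn : (#|V| <= n)%N by rewrite -[X in (_ <= X)%N](card_ord n) max_card.
have jV : (0 < #|V| + k - n <= #|V|)%N by lia.
have [r [L [rj HL]]] := eig_constraints (sub_adj_sym sub) (fun a => mu0 (enum_val a)) jV.
exists (r + #|~: V|)%N, (row_mx (restr V *m L) (restr (~: V))); split.
  by rewrite cardsCs finset.setCK card_ord; lia.
move=> g; rewrite mul_mx_row -row_mx0 => /eq_row_mx[gL gC].
rewrite norm_adj_negE -(qform_sub_adj g sub) -(wnorm_restr (V := V)).
  by apply: HL; rewrite -mulmxA.
move=> i iV; have iC : i \in ~: V by rewrite finset.in_setC.
have /matrixP/(_ ord0 (enum_rank_in iC i)) := gC.
by rewrite restrE enum_rankK_in// mxE.
Qed.

(** The missing vertices return as isolated ones; the same fewer than [k] equations bound the [k]-th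
    eigenvalue of the spanning subgraph from below. *)
Lemma eig_spanning_ge V E k :
    is_subgraph adj V E -> (0 < k <= n)%N -> (n - k + 1 <= #|V|)%N ->
  is_subgraph adj [set: 'I_n]%SET E /\
  eig (norm_adj_neg V E sigma w mu) (#|V| + k - n)
  <= eig (norm_adj_neg [set: 'I_n]%SET E sigma w mu) k.
Proof.
move=> sub kn kV; have [r [L [rk HL]]] := subgraph_constraints sub kn kV.
have subT : is_subgraph adj [set: 'I_n]%SET E.
  by case: sub => Es Ea; split=> // i j /Ea[ij _ _]; rewrite !finset.in_setT.
split=> //; rewrite [in leRHS]norm_adj_negE.
have kT : (0 < k <= #|[set: 'I_n]%SET|)%N by rewrite cardsT card_ord.
apply: (le_eig (sub_adj_sym subT) (fun a => mu0 (enum_val a)) kT (r := r)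
  (L := (restr [set: 'I_n]%SET)^T *m L)) => // h hL.
have hE : h = (h *m (restr [set: 'I_n]%SET)^T) *m restr [set: 'I_n]%SET.
  by rewrite -mulmxA restr_trK mulmx1.
rewrite hE (qform_sub_adj _ subT) wnorm_restr; last by move=> i; rewrite finset.in_setT.
by apply: HL; rewrite -mulmxA.
Qed.

Lemma eig_le_cutL V E k :
    is_subgraph adj V E -> (0 < k <= n)%N -> (n - k + 1 <= #|V|)%N ->
  eig (norm_adj_neg V E sigma w mu) (#|V| + k - n) / 2 <= cutL adj sigma w mu k.
Proof.
move=> sub kn kV; have [r [L [rk HL]]] := subgraph_constraints sub kn kV.
apply: (le_cutL Gsg kn) => B [BS _ _ Bk].
(* If [B] missed the kernel of [L], then [g *m L] would be an odd nonvanishing map into dimension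
   [r < k], against the genus. *)
have [g Bg gL] : exists2 g, B g & g *m L = 0.
  apply: contrapT => H; apply: (Bk r rk).
  exists (fun g => g *m L); split.
  - apply: continuous_subspaceT => g; apply: continuous_coord => j.
    have -> : (fun y : 'rV[R]_n => (y *m L) ord0 j) = fun y => \sum_i y ord0 i * L i j.
      by apply/funext => y; rewrite mxE.
    have c i : continuous (fun y : 'rV[R]_n => y ord0 i) by exact: coord_continuous.
    by apply: continuous_sum => i _ x; exact: (cvgM (c i x) (cvg_cst _)).
  - by move=> g _; rewrite mulNmx.
  - by move=> g Bg; apply/eqP => gL; apply: H; exists g.
exists g => //; rewrite ler_pdivrMr// mulrC.
apply: le_trans (edge_form_le_cutQ g sub).
by have := HL g gL; rewrite -pden2 (BS _ Bg) mulr1.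
Qed.

Definition cut_edges g : rel 'I_n :=
  fun i j => adj i j && (sigma i j * g ord0 i * g ord0 j < 0).

Lemma cut_edges_subgraph g : is_subgraph adj [set: 'I_n]%SET (cut_edges g).
Proof.
case: Gsg => as_ _ ss _ _; split=> [i j|i j /andP[ij _]]; last by rewrite !finset.in_setT.
rewrite /cut_edges (as_ j i); have [ij|//] := boolP (adj i j).
have [-> _] := ss _ _ ij.
by rewrite mulrAC.
Qed.

(** Switching by the sign of [g] works: both ends of a cut edge have nonzero values, so the choice
    made at zeros is immaterial. *)
Lemma cut_edges_antibalanced g : antibalanced (cut_edges g) sigma.
Proof.
exists (fun i => if 0 < g ord0 i then 1 else -1); split=> [i|i j /andP[ij]].
  by case: ifP; [left|right].
case: Gsg => _ _ /(_ i j ij)[_ s1] _ _.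
have [gi|gi] := ltP 0 (g ord0 i); have [gj|gj] := ltP 0 (g ord0 j);
  case: s1 => ->; rewrite ?(mul1r, mulr1, mulN1r, mulrN1, opprK) // => h; exfalso; nra.
Qed.

Lemma cutQ_edge_form g : 2 * cutQ adj sigma w g = edge_form (cut_edges g) g.
Proof.
rewrite (edge_formE g (cut_edges_subgraph g)); congr (_ * _).
apply: eq_bigr => i _; apply: eq_bigr => j /andP[_ ij].
rewrite /cut_edges ij /=; case: ltP => h.
  by rewrite (max_idPr _)// oppr_ge0 ltW.
by rewrite (max_idPl _) ?mulr0// oppr_le0.
Qed.

Lemma cutQ_le_eig g : (0 < n)%N -> psphere mu 2 g ->
  cutQ adj sigma w g <=
  eig (norm_adj_neg [set: 'I_n]%SET (cut_edges g) sigma w mu) n / 2.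
Proof.
move=> n0 gS; have sub := cut_edges_subgraph g.
rewrite ler_pdivlMr// mulrC cutQ_edge_form -(qform_sub_adj g sub).
have nT : n = #|[set: 'I_n]%SET| by rewrite cardsT card_ord.
have nT' : (0 < n <= #|[set: 'I_n]%SET|)%N by rewrite -nT leqnn n0.
have := qform_le_eig (sub_adj_sym sub) (fun a => mu0 (enum_val a)) nT'
  (g *m restr [set: 'I_n]%SET) nT.
rewrite wnorm_restr; last by move=> i; rewrite finset.in_setT.
by rewrite -pden2 gS mulr1 norm_adj_negE.
Qed.

End Subgraphs.

(** * Comparison of the three suprema with the cut-off eigenvalues *)

Theorem theorem5p1 (R : realType) (n : nat) (adj : rel 'I_n)
    (sigma w : 'I_n -> 'I_n -> R) (mu kappa : 'I_n -> R) (k : nat) :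
  signed_graph adj sigma w mu ->
  (1 <= k <= n)%N ->
  let maxA := sup [set x | exists V0 E0, [/\ is_subgraph adj V0 E0,
                     (n - k + 1 <= #|V0|)%N &
                     x = eig (norm_adj_neg V0 E0 sigma w mu) (#|V0| + k - n)]] in
  let maxB := sup [set x | exists V0 E0, [/\ is_subgraph adj V0 E0,
                     #|V0| = n &
                     x = eig (norm_adj_neg V0 E0 sigma w mu) k]] in
  let maxC := sup [set x | exists V0 E0, [/\ is_subgraph adj V0 E0,
                     #|V0| = n, antibalanced E0 sigma &
                     x = eig (norm_adj_neg V0 E0 sigma w mu) n]] in
  [/\ Lcut adj sigma w mu kappa k >= maxA / 2,
      maxA = maxB &
      (k = n -> Lcut adj sigma w mu kappa k = maxA / 2 /\
                Lcut adj sigma w mu kappa n = maxC / 2)].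
Proof.
move=> Gsg kn maxA maxB maxC; have /andP[k0 kn'] := kn.
rewrite (Lcut_cutL kappa Gsg kn).
have cardT : #|[set: 'I_n]%SET| = n by rewrite cardsT card_ord.
have n0 : (0 < n)%N := leq_trans k0 kn'.
pose A := [set x | exists V0 E0, [/\ is_subgraph adj V0 E0,
   (n - k + 1 <= #|V0|)%N & x = eig (norm_adj_neg V0 E0 sigma w mu) (#|V0| + k - n)]].
pose B := [set x | exists V0 E0, [/\ is_subgraph adj V0 E0,
   #|V0| = n & x = eig (norm_adj_neg V0 E0 sigma w mu) k]].
pose C := [set x | exists V0 E0, [/\ is_subgraph adj V0 E0,
   #|V0| = n, antibalanced E0 sigma & x = eig (norm_adj_neg V0 E0 sigma w mu) n]].
have BA : B `<=` A.
  move=> x [V0 [E0 [sub Vn ->]]]; exists V0, E0; split=> //; first by lia.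
  by congr eig; lia.
have A_le x : A x -> x <= 2 * cutL adj sigma w mu k.
  move=> [V0 [E0 [sub kV ->]]].
  by have := eig_le_cutL Gsg sub kn kV; rewrite ler_pdivrMr// mulrC.
have Aub : has_ubound A by exists (2 * cutL adj sigma w mu k) => x /A_le.
have Bub : has_ubound B by exists (2 * cutL adj sigma w mu k) => x /BA/A_le.
have C_B : k = n -> C `<=` B.
  by move=> kE x [V0 [E0 [sub Vn _ ->]]]; exists V0, E0; rewrite kE.
(* The vector 0 cuts no edge, so the edgeless spanning subgraph is an antibalanced candidate; [sup]
   is then taken over nonempty bounded sets. *)
have C0 : C !=set0.
  have sub := cut_edges_subgraph Gsg 0.
  exists (eig (norm_adj_neg [set: 'I_n]%SET (cut_edges adj sigma 0) sigma w mu) n).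
  by exists [set: 'I_n]%SET, (cut_edges adj sigma 0); split=> //; exact: cut_edges_antibalanced Gsg _.
have B0 : B !=set0.
  case: C0 => _ [V0 [E0 [sub Vn _ _]]].
  by exists (eig (norm_adj_neg V0 E0 sigma w mu) k), V0, E0.
have A0 : A !=set0 by case: B0 => x /BA; exists x.
have LA : maxA / 2 <= cutL adj sigma w mu k.
  by rewrite ler_pdivrMr// mulrC; apply: ge_sup => // x /A_le.
have AB : maxA = maxB.
  apply/eqP; rewrite eq_le; apply/andP; split; apply: ge_sup => // x.
    move=> [V0 [E0 [sub kV ->]]]; have [subT le] := eig_spanning_ge Gsg sub kn kV.
    apply: (le_trans le); apply: ub_le_sup => //.
    by exists [set: 'I_n]%SET, E0.
  by move=> /BA Ax; exact: ub_le_sup.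
split=> // kE; subst k.
have CB : maxC <= maxB.
  by apply: ge_sup => // x /(C_B erefl) Bx; exact: ub_le_sup.
(* With the whole sphere as competitor, this closes the chain [cutL <= maxC / 2 <= maxB / 2 = maxA /
   2 <= cutL] at [k = n]. *)
have LC : cutL adj sigma w mu n <= maxC / 2.
  apply: (le_trans (cutL_le Gsg n0 (Fk_sphere _ (leqnn n)))).
    by case: Gsg.
  apply: ge_sup.
    have [g Sg] := Fk_nonempty n0 (@Fk_sphere R n mu (let: And5 _ _ _ _ h := Gsg in h) n (leqnn n)).
    by exists (cutQ adj sigma w g); exists g.
  move=> _ [g gS <-]; apply: (le_trans (cutQ_le_eig Gsg n0 gS)).
  rewrite ler_pM2r ?invr_gt0//; apply: ub_le_sup.
    by exists (2 * cutL adj sigma w mu n) => x /(C_B erefl)/BA/A_le.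
  exists [set: 'I_n]%SET, (cut_edges adj sigma g); split=> //.
    exact: cut_edges_subgraph Gsg _.
  exact: cut_edges_antibalanced Gsg _.
rewrite (Lcut_cutL kappa Gsg kn); split; apply/eqP; rewrite eq_le ?LA ?LC ?andbT/=.
  by rewrite AB (le_trans LC)// ler_pM2r ?invr_gt0.
by apply: le_trans LA; rewrite AB ler_pM2r ?invr_gt0.
Qed.
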